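(* Let $n\ge1$, $D=[0,1]^n$, $\mathbf{r}\in\{0,1\}^n$, and $M=\{i\in\{1,\dots,n\}: r_i=1\}$. Let $\Omega:\mathbb{R}^n_+\to\mathbb{R}$, $\boldsymbol\gamma\mapsto\Omega(\boldsymbol\gamma)$, be an arbitrary MC-type function that is concave with respect to $\gamma_i$ for each $i\notin M$. Then for every $\mathbf{m}=(m_1,\dots,m_n)\in\mathbb{N}^n$ with $m_i\ge2$, $i=1,\dots,n$, $$E^{\mathbf{r}}_{\mathbf{m}}\left(C^{\mathbf{r}}_D(\Omega)\right)=\left(\prod_{i\in M}m_i\right)\int_R\Omega(\mathbf{h})\prod_{i\in M}d\gamma_i,$$ where $R=\prod_{i\in M}[0,\frac1{m_i}]$ and $\mathbf{h}=(h_1,\dots,h_n)$ with $h_i=\gamma_i$ if $i\in M$ and $h_i=\frac{1}{2m_i}$ if $i\notin M$. Here $$E^{\mathbf{r}}_{\mathbf{m}}(C^{\mathbf{r}}_D(\Omega))=\sup\left\{\sup_{\mathbf{x}\in D}\left|f^{(\mathbf{r})}(\mathbf{x})-S^{(\mathbf{r})}_{\mathbf{m}}(f;\mathbf{x})\right| : f\in C^{\mathbf{r}}_D(\Omega)\right\}.$$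
   Context: Notation: $\mathbb{R}^n_+=\{\mathbf{x}\in\mathbb{R}^n: x_i\ge 0,\ i=1,\dots,n\}$. MC-type function: a function $\Omega$ on $\mathbb{R}^n_+$ such that (1) $\Omega(\mathbf{0})=0$; (2) $\Omega$ is non-decreasing (with respect to the coordinatewise order, i.e. in each variable); (3) $\Omega(\boldsymbol\tau+\boldsymbol\gamma)\le\Omega(\boldsymbol\tau)+\Omega(\boldsymbol\gamma)$ for all $\boldsymbol\tau,\boldsymbol\gamma\in\mathbb{R}^n_+$; (4) $\Omega$ is continuous. Derivatives and smoothness: for $\mathbf{t}\in\{0,1\}^n$, $f^{(\mathbf{t})}=\dfrac{\partial^{t_1+\dots+t_n}f}{\partial x_1^{t_1}\cdots\partial x_n^{t_n}}$, with $f^{(\mathbf{0})}=f$. $C^{\mathbf{r}}_D$ is the class of continuous functions $f:D\to\mathbb{R}$ having continuous derivatives $f^{(\mathbf{t})}$ on $D$ for all $\mathbf{t}\in\{0,1\}^n$ with $t_i\le r_i$, $i=1,\dots,n$. Total modulus of continuity: for bounded $g$ on $D$ and $0\le\tau_i\le1$, $$\omega(g;\boldsymbol\tau)=\sup\{|g(\mathbf{x})-g(\mathbf{y})| : \mathbf{x},\mathbf{y}\in D,\ |x_i-y_i|\le\tau_i,\ i=1,\dots,n\}.$$ Class $C^{\mathbf{r}}_D(\Omega)$: all $f\in C^{\mathbf{r}}_D$ with $\omega(f^{(\mathbf{r})};\boldsymbol\tau)\le\Omega(\boldsymbol\tau)$ for all $\boldsymbol\tau$ with $0\le\tau_i\le1$.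 Interpolating multilinear spline: given $\mathbf{m}\in\mathbb{N}^n$, the nodes are $\mathbf{x}^{\mathbf{j}}=(j_1/m_1,\dots,j_n/m_n)$, $j_i\in\{0,\dots,m_i\}$. For continuous $f$ on $D$ and $\mathbf{x}$ in the block $D_{\mathbf{j}}=\prod_{i=1}^n[\frac{j_i}{m_i},\frac{j_i+1}{m_i}]$, $j_i\in\{0,\dots,m_i-1\}$, $$S_{\mathbf{m}}(f;\mathbf{x})=\sum_{\mathbf{l}\in\{0,1\}^n} f(\mathbf{x}^{\mathbf{j}+\mathbf{l}})\prod_{i=1}^n H_{l_i,j_i}(x_i),\quad H_{0,j_i}(x_i)=m_i\left(\tfrac{j_i+1}{m_i}-x_i\right),\quad H_{1,j_i}(x_i)=1-H_{0,j_i}(x_i);$$ this is the unique function on $D$ that is of degree at most one in each variable separately on every block and interpolates $f$ at all nodes. Derivative of the spline: it may be discontinuous across block boundaries, and $S^{(\mathbf{r})}_{\mathbf{m}}(f;\mathbf{x})$ is defined at every $\mathbf{x}\in D$ as follows. Partition $D$ into the sets $D'_{\mathbf{j}}=\prod_{i=1}^n I_{i}$, where $I_i=[\frac{j_i}{m_i},\frac{j_i+1}{m_i})$ if $0\le j_i\le m_i-2$ and $I_i=[\frac{j_i}{m_i},\frac{j_i+1}{m_i}]$ if $j_i=m_i-1$. For $\mathbf{x}\in D'_{\mathbf{j}}$, $S^{(\mathbf{r})}_{\mathbf{m}}(f;\mathbf{x})$ is the value at $\mathbf{x}$ of the $\mathbf{r}$-th partial derivative of the polynomial representing $S_{\mathbf{m}}(f;\cdot)$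 on $D_{\mathbf{j}}$, i.e. $$S^{(\mathbf{r})}_{\mathbf{m}}(f;\mathbf{x})=\left(\prod_{i\in M}m_i\right)\sum_{\mathbf{l}\in\{0,1\}^n}(-1)^{|M|+\sum_{i\in M}l_i}\left(\prod_{i\notin M}H_{l_i,j_i}(x_i)\right)f(\mathbf{x}^{\mathbf{j}+\mathbf{l}}).$$ Convention: if $M=\emptyset$, empty products equal $1$ and the integral over $R$ is simply the value of the integrand. *)

(* Defs.v *)
From HB Require Import structures.
From mathcomp Require Import all_boot all_order all_algebra.
From mathcomp Require Import all_classical all_reals all_analysis.

Set Implicit Arguments.
Unset Strict Implicit.
Unset Printing Implicit Defensive.

Import Order.TTheory GRing.Theory Num.Theory.
Import numFieldNormedType.Exports.

Local Open Scope classical_set_scope.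
Local Open Scope ring_scope.

Section MultilinearSplines.
Context {R : realType} {n : nat}.

Implicit Types (A : set 'rV[R]_n) (x y h : 'rV[R]_n) (i : 'I_n).
Implicit Types (f g Omega : 'rV[R]_n -> R) (F : set ('rV[R]_n -> R)).
(* [t] and [r] are multi-indices in {0,1}^n. *)
Implicit Types (t r l : {ffun 'I_n -> bool}) (m j : 'I_n -> nat).

Definition orthant : set 'rV[R]_n := [set x | forall i, 0 <= x ord0 i].

Definition cube : set 'rV[R]_n := [set x | forall i, 0 <= x ord0 i <= 1].

Definition upd x i (s : R) : 'rV[R]_n :=
  \row_k (if k == i then s else x ord0 k).

(* Functions on the orthant or on the cube are represented by total functions;
   nothing below depends on their values outside of these sets. *)
Record mc_type Omega : Prop := McType {
  mc_type0 : Omega 0 = 0;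
  mc_type_homo : forall x y, orthant x -> orthant y ->
    (forall i, x ord0 i <= y ord0 i) -> Omega x <= Omega y;
  mc_type_subadd : forall x y, orthant x -> orthant y ->
    Omega (x + y) <= Omega x + Omega y;
  mc_type_continuous : {within orthant, continuous Omega} }.

Definition concave_coord Omega i : Prop := forall x, orthant x ->
  convex_function (`[0, +oo[%classic : set R^o)
    (fun s : R^o => - Omega (upd x i s)).

(* Partial derivatives relative to A: increments stay in A, so that on the
   boundary of the cube they are the one-sided derivatives. *)
Definition diff_quot f i x : R -> R :=
  fun s => s^-1 * (f (s *: delta_mx ord0 i + x) - f x).

Definition incr_filter A i x : set_system R :=
  within [set s | A (s *: delta_mx ord0 i + x)] 0^'.

Definition partial_derivable A i f x : Prop :=
  cvg (diff_quot f i x @ incr_filter A i x).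

Definition partial A i f x : R :=
  lim (diff_quot f i x @ incr_filter A i x).

Lemma partial_derivable_setT i f x :
  partial_derivable setT i f x = derivable f x (delta_mx ord0 i).
Proof.
rewrite /partial_derivable /incr_filter (_ : [set _ | _] = setT).
  by rewrite withinET.
by apply/seteqP; split.
Qed.

Lemma partial_setT i f x : partial setT i f x = 'D_(delta_mx ord0 i) f x.
Proof.
rewrite /partial /incr_filter (_ : [set _ | _] = setT).
  by rewrite withinET.
by apply/seteqP; split.
Qed.

Definition support_seq t : seq 'I_n := [seq i <- enum 'I_n | t i].

(* partials A [:: i1; ...; ik] f = d/dx_i1 (... (d/dx_ik f)) *)
Definition partials A (s : seq 'I_n) f : 'rV[R]_n -> R :=
  foldr (partial A) f s.

Fixpoint partials_exist A (s : seq 'I_n) f : Prop :=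
  if s is i :: s' then
    partials_exist A s' f /\
    forall x, A x -> partial_derivable A i (partials A s' f) x
  else True.

Definition mixed_deriv A t f : 'rV[R]_n -> R := partials A (support_seq t) f.

Definition smooth r f : Prop := forall t, (forall i, t i <= r i)%N ->
  partials_exist cube (support_seq t) f /\
  {within cube, continuous (mixed_deriv cube t f)}.

(* The supremum is taken in \bar R, hence is meaningful for every g. *)
Definition total_modulus g (tau : 'rV[R]_n) : \bar R :=
  ereal_sup [set e | exists x y, [/\ cube x, cube y,
    (forall i, `|x ord0 i - y ord0 i| <= tau ord0 i) &
    e = `|g x - g y|%:E]].

Definition smooth_class r Omega : set ('rV[R]_n -> R) :=
  [set f | smooth r f /\ forall tau, cube tau ->
    (total_modulus (mixed_deriv cube r f) tau <= (Omega tau)%:E)%E].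

Definition node m j : 'rV[R]_n := \row_i ((j i)%:R / (m i)%:R).

Definition hat (l : bool) (mi ji : nat) (s : R) : R :=
  let H0 := mi%:R * (ji.+1%:R / mi%:R - s) in if l then 1 - H0 else H0.

(* The polynomial that represents the interpolating multilinear spline of f on
   the block of index j; it is a function on the whole space. *)
Definition block_poly m j f : 'rV[R]_n -> R := fun x =>
  \sum_(l : {ffun 'I_n -> bool})
    f (node m (fun i => j i + l i)%N) *
    \prod_(i < n) hat (l i) (m i) (j i) (x ord0 i).

(* The half-open blocks (closed on the right for the last index) that
   partition the cube. *)
Definition cell m j : set 'rV[R]_n := [set x | forall i,
  (j i)%:R / (m i)%:R <= x ord0 i /\
  if (j i).+1 == m i then x ord0 i <= (j i).+1%:R / (m i)%:R
  else x ord0 i < (j i).+1%:R / (m i)%:R].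

Definition cell_index m x : 'I_n -> nat :=
  fun i => minn (Num.truncn (x ord0 i * (m i)%:R)) (m i).-1.

Lemma cell_indexP m j x : (forall i, 0 < m i)%N -> cube x ->
  (forall i, j i < m i)%N -> cell m j x <-> j = cell_index m x.
Proof.
move=> m_gt0 Dx jm.
have mR i : 0 < (m i)%:R :> R by rewrite ltr0n.
have xm_ge0 i : 0 <= x ord0 i * (m i)%:R.
  by case/andP: (Dx i) => x0 _; rewrite mulr_ge0.
have xm_le i : x ord0 i * (m i)%:R <= (m i)%:R.
  by case/andP: (Dx i) => _ x1; rewrite ler_piMl.
split=> [jx|->] //.
  apply/funext => i; have [] := jx i; rewrite ler_pdivrMr// => j1 j2.
  rewrite /cell_index; apply/eqP; rewrite eqn_leq leq_min.
  rewrite Num.Theory.truncn_ge_nat// j1 -ltnS prednK// jm /=.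
  case: eqP j2 => [jE _|_]; first by rewrite -jE /= geq_minr.
  rewrite ltr_pdivlMr// => j2; rewrite geq_min.
  by rewrite -ltnS Num.Theory.truncn_lt_nat// j2.
move=> i; rewrite ler_pdivrMr// ltr_pdivlMr// ler_pdivlMr//.
rewrite /cell_index; split.
  rewrite -Num.Theory.truncn_ge_nat//; exact: geq_minl.
case: eqP => [->//|].
rewrite /minn; case: ltnP => [_ _|_]; last by rewrite prednK.
by case/andP: (Num.Theory.truncn_itv (xm_ge0 i)).
Qed.

Definition spline_deriv m r f x : R :=
  mixed_deriv setT r (block_poly m (cell_index m x) f) x.

Definition approx_error m r F : \bar R :=
  ereal_sup [set ereal_sup
    [set `|mixed_deriv cube r f x - spline_deriv m r f x|%:E | x in cube]
  | f in F].

(* Iterated Lebesgue integral, over the box of the [0, b i] for i in s, of g in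
   the coordinates listed by s; the other coordinates keep their value in h. *)
Definition box_integral (s : seq 'I_n) (b : 'I_n -> R) g h : R :=
  foldr (fun i G h' => \int[lebesgue_measure]_(u in `[0, b i]) G (upd h' i u))
    g s h.

End MultilinearSplines.

(* Main.v *)
(** Integrating the mixed derivative [g = f^(r)] over the block containing [x]
    turns the derivative of the spline at [x] into an iterated mean of [g]: a
    plain average over the edge of the block in the directions [i] with [r i],
    and a barycentric combination of two nodes in the other directions.  The
    error is therefore at most the same iterated mean of [y |-> Omega |x - y|].
    One direction at a time, folding the edge at [x_i] (monotonicity) or
    Jensen's inequality (concavity) bounds this mean by its value for the
    midpoint or the corner of the block, which is the constant of the theorem.
    Both inequalities are equalities at the point [x0] of the first block with
    coordinates [0] where [r i] and [1 / (2 m_i)] elsewhere when [g] is the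
    function [y |-> Omega |x0 - y|]; subadditivity of [Omega] puts every
    iterated primitive of this function in the class. *)
Require Import Defs.
From mathcomp Require Import all_boot all_order all_algebra.
From mathcomp Require Import all_classical all_reals all_analysis.
From mathcomp Require Import ring lra.
Import Order.TTheory GRing.Theory Num.Theory.
Import numFieldNormedType.Exports.

Set Implicit Arguments.
Unset Strict Implicit.
Unset Printing Implicit Defensive.
Local Open Scope classical_set_scope.
Local Open Scope ring_scope.

(** * Integrals over segments: parameters, primitives, exchange of order *)

Section SegmentIntegral.
Context {R : realType}.
Local Notation mu := (@lebesgue_measure R).
Implicit Types (a b c d : R) (f g : R -> R).

Lemma integrable_segment a b f :
  {within `[a, b], continuous f} -> mu.-integrable `[a, b] (EFin \o f).
Proof.
by move=> cf; apply: continuous_compact_integrable => //; exact: segment_compact.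
Qed.

Lemma integral_segment_cst a b c : a <= b -> \int[mu]_(u in `[a, b]) c = c * (b - a).
Proof.
move=> ab; rewrite Rintegral_cst//; congr (_ * _).
rewrite /= lebesgue_measure_itv/= lte_fin; case: ltP => [//|ba /=].
by rewrite (@le_anti _ _ a b) ?ab// subrr.
Qed.

Lemma integral_segment_dist a b c f g : a <= b ->
  {within `[a, b], continuous f} -> {within `[a, b], continuous g} ->
  (forall u, a <= u <= b -> `|f u - g u| <= c) ->
  `|\int[mu]_(u in `[a, b]) f u - \int[mu]_(u in `[a, b]) g u| <= c * (b - a).
Proof.
move=> ab cf cg fg.
have cfg : {within `[a, b], continuous (fun u => f u - g u)}.
  by move=> u; apply: cvgB; [exact: cf|exact: cg].
rewrite -RintegralB//; [|exact: integrable_segment..].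
apply: le_trans (le_normr_Rintegral _ _) _ => //; first exact: (integrable_segment cfg).
rewrite -integral_segment_cst//; apply: le_Rintegral => //.
- apply: integrable_segment => u; apply: cvg_norm; exact: cfg.
- apply: integrable_segment => u; exact: cvg_cst.
Qed.

Lemma continuous_curryr (T : topologicalType) (H : T -> R -> R) x :
  continuous (fun p : T * R => H p.1 p.2) -> continuous (H x).
Proof.
move=> cH u.
have := @continuous2_cvg _ _ _ _ _ _ (fun=> x) id H x u (cH (x, u)).
by move/(_ (nbhs u) _ (cvg_cst x) cvg_id).
Qed.

(** Compactness of [[a, b]]: around each [u] the estimate holds on a product of neighbourhoods of
    [u] and [x], and finitely many of these cover the segment. *)
Lemma near_segment_uniform (T : topologicalType) (H : T -> R -> R) a b x e :
  continuous (fun p : T * R => H p.1 p.2) -> 0 < e ->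
  \forall y \near x, forall u, a <= u <= b -> `|H x u - H y u| <= e.
Proof.
move=> cH e0.
have /compact_near_coveringP cov := @segment_compact R a b.
apply: filter_app (cov _ (nbhs x) (fun y u => `|H x u - H y u| <= e) _ _).
  by apply: nearW => y Py u uab; apply: (Py u); rewrite /= in_itv.
move=> u uab.
have e20 : 0 < e / 2 by rewrite divr_gt0.
have /cvgrPdist_lt/(_ _ e20) := cH (x, u).
have /cvgrPdist_lt/(_ _ e20) := @continuous_curryr _ H x cH u.
move=> h1 [[A B] /= [xA uB] AB].
exists ((B `&` [set t | `|H x u - H x t| < e / 2]), A).
  split => //=; apply: filterI => //; exact: h1.
move=> [v y] /= [[Bv hv] Ay].
have /= h2 := AB (y, v) (conj Ay Bv).
rewrite (_ : H x v - H y v = (H x u - H y v) - (H x u - H x v)); last by ring.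
apply: le_trans (ler_normB _ _) _; rewrite (splitr e); apply: lerD; exact: ltW.
Qed.

Lemma continuous_integral_param (T : topologicalType) (H : T -> R -> R) a b :
  continuous (fun p : T * R => H p.1 p.2) ->
  continuous (fun x => \int[mu]_(u in `[a, b]) H x u).
Proof.
move=> cH x.
have [ab|ba] := leP a b; last first.
  rewrite (_ : (fun _ => _) = cst 0); first exact: cvg_cst.
  by apply/funext => y; rewrite set_itv_ge ?Rintegral_set0// bnd_simp -ltNge.
apply/cvgrPdist_le => e e0.
have ba0 : 0 < b - a + 1 by rewrite ltr_wpDl// subr_ge0.
have e'0 : 0 < e / (b - a + 1) by rewrite divr_gt0.
apply: filter_app (near_segment_uniform a b x cH e'0).
apply: nearW => y Hy.
apply: le_trans (integral_segment_dist ab _ _ Hy) _.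
- exact/continuous_subspaceT/continuous_curryr.
- exact/continuous_subspaceT/continuous_curryr.
- rewrite mulrAC ler_pdivrMr// ler_wpM2l ?(ltW e0)// lerDl; exact: ler01.
Qed.

Lemma derive_primitive f A b : A < b -> continuous f ->
  is_derive b 1 (fun t => \int[mu]_(u in `[A, t]) f u) (f b).
Proof.
move=> Ab cf.
(* The segment is prolonged to [b + 1] so that [b] is an inner point of it. *)
have intf : mu.-integrable `[A, b + 1] (EFin \o f).
  by apply: integrable_segment; exact: continuous_subspaceT.
have bb1 : b < b + 1 by rewrite ltrDl.
have [df dfE] := continuous_FTC1_closed bb1 intf Ab (cf b).
by apply: DeriveDef; [exact: df|rewrite -derive1E; exact: dfE].
Qed.

(** The difference splits in two: the upper bound moves while the integrand stays at [x], then the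
    integrand moves while the upper bound stays at [c y]. *)
Lemma continuous_integral_upper (T : topologicalType) (H : T -> R -> R) (c : T -> R) A :
  continuous c -> (forall x, A < c x) ->
  continuous (fun p : T * R => H p.1 p.2) ->
  continuous (fun x => \int[mu]_(u in `[A, c x]) H x u).
Proof.
move=> cc Ac cH x.
have cHx y : continuous (H y) by exact: continuous_curryr.
apply/cvgrPdist_le => e e0.
pose p t := \int[mu]_(u in `[A, t]) H x u.
have cp : {for c x, continuous p}.
  have [dp _] := derive_primitive (Ac x) (cHx x).
  exact/differentiable_continuous/derivable1_diffP.
have e20 : 0 < e / 2 by rewrite divr_gt0.
have /cvgrPdist_le/(_ _ e20) np : p (c y) @[y --> x] --> p (c x).
  by apply: (@cvg_comp _ _ _ c p); [exact: cc|exact: cp].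
(* [B] is the length of [[A, c x + 1]], which contains [[A, c y]] for [y] near [x]. *)
pose B := c x - A + 1.
have B0 : 0 < B by have := Ac x; rewrite /B; lra.
have e'0 : 0 < e / 2 / B by rewrite divr_gt0.
have nu := @near_segment_uniform _ H A (c x + 1) x _ cH e'0.
have nc : \forall y \near x, c y < c x + 1.
  by apply: (cvgr_lt (c x)); [exact: cc|rewrite ltrDl].
near=> y.
have cyB : c y < c x + 1 by near: y.
have pe : `|p (c x) - p (c y)| <= e / 2 by near: y.
have He u : A <= u <= c x + 1 -> `|H x u - H y u| <= e / 2 / B.
  by move: u; near: y.
rewrite (splitr e) -[X in `|X|](subrKA (p (c y))).
apply: le_trans (ler_normD _ _) _; apply: lerD => //.
apply: le_trans (@integral_segment_dist _ _ (e / 2 / B) _ _ (ltW (Ac y)) _ _ _) _.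
- exact: continuous_subspaceT.
- exact: continuous_subspaceT.
- by move=> u /andP[u1 uc]; apply: He; rewrite u1 (le_trans uc)// ltW.
- by rewrite mulrAC ler_pdivrMr// ler_wpM2l ?(ltW e20)// /B; lra.
Unshelve. all: by end_near. Qed.

Lemma integral_segment_cat f a b c : a <= b -> b <= c -> continuous f ->
  \int[mu]_(u in `[a, c]) f u =
  \int[mu]_(u in `[a, b]) f u + \int[mu]_(u in `[b, c]) f u.
Proof.
move=> ab bc cf; apply/eqP; rewrite addrC -subr_eq; apply/eqP.
rewrite Rintegral_itvB ?bnd_simp//; last first.
  by apply: integrable_segment; exact: continuous_subspaceT.
rewrite Rintegral_itv_obnd_cbnd//.
apply: integrableS (integrable_segment (a := b) (b := c) _) => //.
- by apply: subset_itvr; rewrite bnd_simp.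
- exact/continuous_subspaceT.
Qed.

Lemma integral_segment_derive f (F : R -> R) a b : a < b ->
  {within `[a, b], continuous f} -> {within `[a, b], continuous F} ->
  (forall u, a < u < b -> is_derive u 1 F (f u)) ->
  \int[mu]_(u in `[a, b]) f u = F b - F a.
Proof.
move=> ab cf cF dF.
have := @continuous_FTC2 R f F a b ab cf.
rewrite /Rintegral => ->//.
- have [_ cFa cFb] := (continuous_within_itvP _ ab).1 cF.
  by split => // u; rewrite in_itv/= => /dF; case.
- by move=> u; rewrite in_itv/= => /dF; rewrite derive1E => -[_ ->].
Qed.

(* Both sides have the same derivative in the upper bound [d]. *)
Lemma integral_segment_swap (H : R -> R -> R) a b c d :
  continuous (fun p : R * R => H p.1 p.2) ->
  \int[mu]_(u in `[a, b]) \int[mu]_(v in `[c, d]) H u v =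
  \int[mu]_(v in `[c, d]) \int[mu]_(u in `[a, b]) H u v.
Proof.
move=> cH; have [cd|dc] := leP c d; last first.
  have cd0 : `[c, d]%classic = set0 :> set R.
    by rewrite set_itv_ge// bnd_simp -ltNge.
  rewrite cd0 Rintegral_set0; under eq_Rintegral do rewrite Rintegral_set0.
  rewrite /Rintegral -[RHS]/(fine 0%E); congr fine; exact: integral0.
have cHs u : continuous (H u) by exact: continuous_curryr.
have cH' : continuous (fun p : R * R => H p.2 p.1).
  move=> [v u]; apply: (@continuous2_cvg _ _ _ _ _ _ snd fst H u v (cH (u, v))).
    exact: cvg_snd.
  exact: cvg_fst.
have cHs' v : continuous (H ^~ v) by exact: (@continuous_curryr _ (fun v u => H u v)).
(* The margins make [c] and [d] inner points of []A, B[], the interval in which the upper bound is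
   differentiated. *)
set A := c - 1; set B := d + 1.
pose F t u := \int[mu]_(v in `[A, t]) H u v.
have cF t : continuous (F t) by exact: continuous_integral_param.
have cG : continuous (fun v => \int[mu]_(u in `[a, b]) H u v).
  exact: (@continuous_integral_param _ (fun v u => H u v)).
have dF t u : A < t -> is_derive t 1 (F ^~ u) (H u t).
  by move=> At; exact: derive_primitive.
(* This bound on a compact rectangle is the majorant for differentiation under the integral sign. *)
have [C HC] : exists C, forall u v, a <= u <= b -> A <= v <= B -> `|H u v| <= C.
  have cK : compact (`[a, b] `*` `[A, B] : set (R * R)).
    by apply: compact_setX; exact: segment_compact.
  have cHK : {within `[a, b] `*` `[A, B], continuous (fun p : R * R => H p.1 p.2)}.
    exact: continuous_subspaceT.
  have [M [_ HM]] := compact_bounded (continuous_compact cHK cK).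
  exists (M + 1) => u v uab vAB.
  apply: (HM (M + 1)); first by rewrite ltrDl.
  by exists (u, v) => //; split; rewrite /= in_itv.
have dphi t : A < t < B ->
    is_derive t 1 (fun s => \int[mu]_(u in `[a, b]) F s u) (\int[mu]_(u in `[a, b]) H u t).
  move=> AtB.
  have AB : A < B by case/andP: AtB; exact: lt_trans.
  have mI : measurable (`[a, b]%classic : set (measurableTypeR R)) by [].
  have It : `]A, B[%classic t by rewrite /= in_itv.
  have intF s : `]A, B[%classic s -> mu.-integrable `[a, b] (EFin \o F s).
    by move=> _; by apply: integrable_segment; exact: continuous_subspaceT.
  have dF' s u : `]A, B[%classic s -> `[a, b]%classic u -> derivable (F ^~ u) s 1.
    by rewrite /= in_itv/= => /andP[As _] _; case: (dF s u As).
  have C0 (u : R) : 0 <= `|C| := normr_ge0 _.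
  have intC : mu.-integrable `[a, b] (EFin \o cst `|C|).
    by apply: integrable_segment => u; exact: cvg_cst.
  have bF s u : `]A, B[%classic s -> `[a, b]%classic u -> `|partial1of2 F s u| <= cst `|C| u.
    rewrite /= !in_itv/= => /andP[As sB] uab.
    rewrite partial1of2E; case: (dF s u As) => _ ->.
    by apply: le_trans (HC u s uab _) (ler_norm _); rewrite !ltW.
  have dE : \int[mu]_(u in `[a, b]) partial1of2 F t u = \int[mu]_(u in `[a, b]) H u t.
    apply: eq_Rintegral => u _; rewrite partial1of2E.
    by case/andP: AtB => At _; case: (dF t u At).
  rewrite -dE -[X in is_derive _ _ _ X](differentiation_under_integral mI It intF dF' C0 intC bF).
  apply: DeriveDef; last by rewrite derive1E.
  exact: (derivable_under_integral mI It intF dF' C0 intC bF).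
move: cd; rewrite le_eqVlt => /predU1P[cd|cd].
  rewrite -cd set_itv1 Rintegral_set1.
  under eq_Rintegral do rewrite Rintegral_set1.
  rewrite /Rintegral -[RHS]/(fine 0%E); congr fine; exact: integral0.
have inAB t : c <= t <= d -> A < t < B.
  by move=> /andP[ct td]; rewrite (lt_le_trans _ ct) ?(le_lt_trans td)// /A /B; lra.
have dphi' t : c < t < d ->
    is_derive t 1 (fun s => \int[mu]_(u in `[a, b]) F s u) (\int[mu]_(u in `[a, b]) H u t).
  by move=> /andP[ct td]; apply: dphi; apply: inAB; rewrite !ltW.
have cphi : {within `[c, d], continuous (fun s => \int[mu]_(u in `[a, b]) F s u)}.
  apply: derivable_within_continuous => t; rewrite in_itv/= => /inAB ABt.
  by case: (dphi t ABt).
have cGw : {within `[c, d], continuous (fun v => \int[mu]_(u in `[a, b]) H u v)}.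
  exact: continuous_subspaceT.
rewrite (integral_segment_derive cd cGw cphi dphi').
have intF t : mu.-integrable `[a, b] (EFin \o F t).
  by apply: integrable_segment; exact: continuous_subspaceT.
rewrite -(RintegralB _ (intF d) (intF c))//; apply: eq_Rintegral => u _.
rewrite /F (@integral_segment_cat (H u) A c d) ?(ltW cd)//; last by rewrite /A; lra.
by rewrite addrC addKr.
Qed.

Lemma continuous_scale (T : topologicalType) (c : R) (f : T -> R) :
  continuous f -> continuous (fun x => c * f x).
Proof. by move=> cf x; apply: cvgM; [exact: cvg_cst|exact: cf]. Qed.

Lemma continuous_add (T : topologicalType) (f g : T -> R) :
  continuous f -> continuous g -> continuous (fun x => f x + g x).
Proof. by move=> cf cg x; apply: cvgD; [exact: cf|exact: cg]. Qed.

End SegmentIntegral.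

(** The head of [s] is moved to its place in [t]; passing an equal entry is trivial, so only
    distinct entries must commute. The invariant [P] is continuity wherever commuting means
    exchanging integrals. *)
Lemma foldr_perm (T : eqType) (A : Type) (P : A -> Prop) (op : T -> A -> A) s t x :
  (forall i y, P y -> P (op i y)) ->
  (forall i j y, i != j -> P y -> op i (op j y) = op j (op i y)) ->
  perm_eq s t -> P x -> foldr op x s = foldr op x t.
Proof.
move=> Pop opC st Px.
have Pf u : P (foldr op x u) by elim: u => //= i u; exact: Pop.
elim: s t st => [|i s IHs] t st.
  by move: st; rewrite perm_sym => /perm_nilP ->.
have it : i \in t by rewrite -(perm_mem st) mem_head.
case/splitPr: it st => t1 t2 st.
have {}st : perm_eq s (t1 ++ t2).
  by rewrite -(perm_cons i) (perm_trans st)// -cat_rcons -cats1 -catA perm_catCA.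
rewrite /= (IHs _ st); elim: t1 {st} => //= j t1 <-.
by have [->//|ij] := eqVneq i j; rewrite opC.
Qed.

Lemma continuous_comp_within (S T U : topologicalType) (A : set T)
    (f : T -> U) (h : S -> T) :
  {within A, continuous f} -> continuous h -> (forall x, A (h x)) ->
  continuous (f \o h).
Proof.
move=> /subspace_continuousP cf ch Ah x.
have chx : (h @ x) `=>` within A (nbhs (h x)).
  move=> B nB; have := ch x _ nB.
  by apply: (@filterS _ (nbhs x)) => y; apply; exact: Ah.
exact: cvg_comp chx (cf (h x) (Ah x)).
Qed.

(** * Changing and integrating single coordinates *)

Section Coordinates.
Context {R : realType} {n : nat}.
Local Notation mu := (@lebesgue_measure R).
Local Notation V := 'rV[R]_n.
Implicit Types (x y : V) (i j k : 'I_n) (F G : V -> R) (s : seq 'I_n).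

Lemma updE x i t k : upd x i t ord0 k = if k == i then t else x ord0 k.
Proof. by rewrite mxE. Qed.

Lemma upd_upd x i t u : upd (upd x i t) i u = upd x i u.
Proof. by apply/rowP => k; rewrite !updE; case: eqP. Qed.

Lemma upd_comm x i j t u : i != j ->
  upd (upd x i t) j u = upd (upd x j u) i t.
Proof.
move=> ij; apply/rowP => k; rewrite !updE.
by have [->|//] := eqVneq k j; rewrite eq_sym (negbTE ij).
Qed.

Lemma upd_id x i : upd x i (x ord0 i) = x.
Proof. by apply/rowP => k; rewrite updE; case: eqP => [->|]. Qed.

Lemma delta_upd x i t : t *: delta_mx ord0 i + x = upd x i (t + x ord0 i).
Proof.
apply/rowP => k; rewrite updE !mxE eqxx/=.
by case: eqP => [->|_]; rewrite ?mulr1// mulr0 add0r.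
Qed.

Lemma subr_upd x y i t : x - upd y i t = upd (x - y) i (x ord0 i - t).
Proof. by apply/rowP => k; rewrite !mxE; case: eqP => [->|]. Qed.

Lemma cube_upd x i t : cube x -> 0 <= t <= 1 -> cube (upd x i t).
Proof. by move=> Dx t01 k; rewrite updE; case: eqP. Qed.

Lemma continuous_row (T : topologicalType) (f : T -> V) :
  (forall k, continuous (fun t => f t ord0 k)) -> continuous f.
Proof.
move=> cf t; apply/cvg_ballP => e e0.
have : \forall u \near t, forall k, ball (f t ord0 k) e (f u ord0 k).
  by apply: filter_forall => k; have /cvg_ballP/(_ _ e0) := cf k t.
by apply: filterS => u H; split => // k l; rewrite (ord1 k).
Qed.

Lemma continuous_coord k : continuous (fun x => x ord0 k).
Proof. exact: coord_continuous. Qed.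

Lemma continuous_upd (T : topologicalType) (f : T -> V) i (g : T -> R) :
  continuous f -> continuous g -> continuous (fun t => upd (f t) i (g t)).
Proof.
move=> cf cg; apply: continuous_row => k.
rewrite (_ : (fun _ => _) = fun t => if k == i then g t else f t ord0 k); last first.
  by apply/funext => t; rewrite updE.
case: eqP => _ // t.
by apply: (@cvg_comp _ _ _ f (fun x => x ord0 k)); [exact: cf|exact: continuous_coord].
Qed.

Lemma continuous_upd_pair i : continuous (fun p : V * R => upd p.1 i p.2).
Proof. by apply: continuous_upd => p; [exact: cvg_fst|exact: cvg_snd]. Qed.

Lemma continuous_comp_upd G x i : continuous G -> continuous (fun t => G (upd x i t)).
Proof.
move=> cG t; apply: (@cvg_comp _ _ _ (upd x i) G); last exact: cG.
apply: (@continuous_upd _ (fun=> x) i id) => ?; [exact: cvg_cst|exact: cvg_id].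
Qed.

Lemma continuous_comp_upd_pair G i :
  continuous G -> continuous (fun p : V * R => G (upd p.1 i p.2)).
Proof.
move=> cG p; apply: (@cvg_comp _ _ _ (fun p => upd p.1 i p.2) G); last exact: cG.
exact: continuous_upd_pair.
Qed.

Definition coord_integral i (a b : R) G : V -> R :=
  fun x => \int[mu]_(u in `[a, b]) G (upd x i u).

Lemma continuous_coord_integral i a b G :
  continuous G -> continuous (coord_integral i a b G).
Proof.
by move=> cG; apply: continuous_integral_param; exact: continuous_comp_upd_pair.
Qed.

Lemma integrable_coord i a b G x : continuous G ->
  mu.-integrable `[a, b] (EFin \o (fun u => G (upd x i u))).
Proof.
move=> cG; apply: integrable_segment; apply: continuous_subspaceT.
exact: continuous_comp_upd.
Qed.

Lemma integral_upd_swap i j a b c d G x : i != j -> continuous G ->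
  \int[mu]_(u in `[a, b]) \int[mu]_(v in `[c, d]) G (upd (upd x i u) j v) =
  \int[mu]_(v in `[c, d]) \int[mu]_(u in `[a, b]) G (upd (upd x j v) i u).
Proof.
move=> ij cG.
rewrite (@integral_segment_swap _ (fun u v => G (upd (upd x i u) j v))).
  apply: eq_Rintegral => v _; apply: eq_Rintegral => u _.
  by rewrite upd_comm.
move=> p; apply: (@cvg_comp _ _ _ (fun p => upd (upd x i p.1) j p.2) G); last exact: cG.
apply: (@continuous_upd _ (fun p => upd x i p.1) j snd) => q; last exact: cvg_snd.
by apply: (@continuous_upd _ (fun=> x) i fst) => {}q; [exact: cvg_cst|exact: cvg_fst].
Qed.

Lemma coord_integralC i j a b c d G : i != j -> continuous G ->
  coord_integral i a b (coord_integral j c d G) =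
  coord_integral j c d (coord_integral i a b G).
Proof. by move=> ij cG; apply/funext => x; exact: integral_upd_swap. Qed.

Lemma coord_integral_upd i j a b G x t : i != j ->
  coord_integral i a b G (upd x j t) =
  coord_integral i a b (fun y => G (upd y j t)) x.
Proof. by move=> ij; apply: eq_Rintegral => u _; rewrite upd_comm// eq_sym. Qed.

Lemma coord_integral_upd_id i a b G x t :
  coord_integral i a b G (upd x i t) = coord_integral i a b G x.
Proof. by apply: eq_Rintegral => u _; rewrite upd_upd. Qed.

End Coordinates.

(** * Partial derivatives on the cube and the fundamental theorem of calculus *)

Section Partials.
Context {R : realType} {n : nat}.
Local Notation mu := (@lebesgue_measure R).
Local Notation V := 'rV[R]_n.
Implicit Types (x y : V) (i j k : 'I_n) (F G P : V -> R) (s : seq 'I_n).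

(** A retraction onto the cube: composing with it makes a function that is continuous on the cube
    continuous everywhere, without changing it on the cube. *)
Definition clamp x : V := \row_k Num.min 1 (Num.max 0 (x ord0 k)).

Lemma cube_clamp x : cube (clamp x).
Proof. by move=> k; rewrite mxE le_min ge_min ler01 le_max !lexx. Qed.

Lemma clamp_id x : cube x -> clamp x = x.
Proof.
move=> Dx; apply/rowP => k; rewrite mxE.
by case/andP: (Dx k) => x0 x1; rewrite max_r// min_r.
Qed.

Lemma continuous_clamp : continuous clamp.
Proof.
apply: continuous_row => k.
rewrite (_ : (fun _ => _) = (fun x => Num.min 1 (Num.max 0 (x ord0 k)))); last first.
  by apply/funext => x; rewrite mxE.
move=> x; apply: (@continuous_min _ _ (cst 1) (fun x => Num.max 0 (x ord0 k))).
  exact: cst_continuous.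
apply: (@continuous_max _ _ (cst 0) (fun x => x ord0 k)); first exact: cst_continuous.
exact: continuous_coord.
Qed.

Lemma continuous_comp_clamp F : {within cube, continuous F} -> continuous (F \o clamp).
Proof.
by move=> cF; apply: continuous_comp_within cF continuous_clamp cube_clamp.
Qed.

(** A coordinate that is at most [1 / 2] can be increased inside the cube, any other one decreased.
    Properness makes the limits of difference quotients unique. *)
Lemma incr_filter_proper i x : cube x -> ProperFilter (incr_filter cube i x).
Proof.
move=> Dx; apply: Build_ProperFilter => -[e /= e0 He].
case/andP: (Dx i) => x0 x1.
pose d := Num.min (e / 2) (1 / 2).
have d0 : 0 < d by rewrite lt_min; apply/andP; split; lra.
have de : d < e by rewrite gt_min; apply/orP; left; lra.
have d1 : d <= 1 / 2 by rewrite ge_min lexx orbT.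
have [xl|xl] := leP (x ord0 i) (1 / 2).
- apply: (He d); rewrite /= ?sub0r ?normrN ?gtr0_norm ?gt_eqF// delta_upd.
  by apply: cube_upd => //; apply/andP; split; lra.
- apply: (He (- d)); rewrite /= ?sub0r ?opprK ?gtr0_norm ?oppr_eq0 ?gt_eqF// delta_upd.
  by apply: cube_upd => //; apply/andP; split; lra.
Qed.

(** Existence and value of the derivative in one convergence statement, which is easily transported
    along equality on the cube. *)
Definition is_partial i F P := forall x, cube x ->
  diff_quot F i x @ incr_filter cube i x --> P x.

Lemma is_partialP i F P : is_partial i F P <->
  (forall x, cube x -> partial_derivable cube i F x /\ partial cube i F x = P x).
Proof.
split=> [FP x Dx|FP x Dx].
  have PF := incr_filter_proper i Dx.
  split; first exact: (cvgP _ (FP x Dx)).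
  exact: (cvg_lim (@Rhausdorff R) (FP x Dx)).
by have [/= dF <-] := FP x Dx; exact: dF.
Qed.

Lemma diff_quot_congr i F G x : cube x -> (forall y, cube y -> F y = G y) ->
  diff_quot F i x @ incr_filter cube i x = diff_quot G i x @ incr_filter cube i x.
Proof.
move=> Dx FG.
have FF : Filter (incr_filter cube i x) by exact: within_filter.
have FGn : incr_filter cube i x [set t | diff_quot F i x t = diff_quot G i x t].
  by apply: filterS (withinT _ _) => t /= Dt; rewrite /diff_quot !FG.
by apply/funext => A; apply/propext; split; rewrite /fmap/=;
  apply: filter_app; apply: filterS FGn => t /= ->.
Qed.

Lemma is_partial_congr i F G P Q : is_partial i F P ->
  (forall y, cube y -> F y = G y) -> (forall y, cube y -> P y = Q y) ->
  is_partial i G Q.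
Proof. by move=> FP FG PQ x Dx; rewrite -(diff_quot_congr _ Dx FG) -PQ//; exact: FP. Qed.

Lemma is_derive_is_partial i F P :
  (forall x, cube x -> is_derive (x ord0 i) 1 (fun t => F (upd x i t)) (P x)) ->
  is_partial i F P.
Proof.
move=> dF x Dx; have [/= dFx <-] := dF x Dx.
move: dFx; rewrite /derivable => dFx.
have -> : diff_quot F i x =
    fun h => h^-1 *: (F (upd x i (h *: 1 + x ord0 i)) - F (upd x i (x ord0 i))).
  by apply/funext => h; rewrite /diff_quot delta_upd upd_id scaler1.
by apply: cvg_trans dFx; apply: cvg_app; exact: cvg_within.
Qed.

(** At an inner coordinate all small increments stay in the cube, so the relative derivative is the
    ordinary one. *)
Lemma is_partial_is_derive i F P x : is_partial i F P -> cube x -> 0 < x ord0 i < 1 ->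
  is_derive (x ord0 i) 1 (fun t => F (upd x i t)) (P x).
Proof.
move=> FP Dx /andP[x0 x1].
have inc : 0^' `=>` incr_filter cube i x.
  move=> A; rewrite /incr_filter /within/= => SA.
  have S : \forall t \near (0^' : set_system R), cube (t *: delta_mx ord0 i + x).
    apply: cvg_within; exists (Num.min (x ord0 i) (1 - x ord0 i)).
      by rewrite /= lt_min x0 subr_gt0.
    move=> t /=; rewrite sub0r normrN lt_min => /andP[tx t1].
    rewrite delta_upd; apply: cube_upd => //.
    by move: tx t1; rewrite !ltr_norml => /andP[? ?] /andP[? ?]; apply/andP; split; lra.
  by apply: filter_app SA; apply: filterS S => t St; apply.
have := FP x Dx.
have -> : diff_quot F i x =
    fun h => h^-1 *: (F (upd x i (h *: 1 + x ord0 i)) - F (upd x i (x ord0 i))).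
  by apply/funext => h; rewrite /diff_quot delta_upd upd_id scaler1.
move=> FPx; have {}FPx := cvg_trans (cvg_app _ inc) FPx.
apply: DeriveDef; first exact: (cvgP _ FPx).
exact: (cvg_lim (@Rhausdorff R) FPx).
Qed.

Definition coord_diff i a b G : V -> R := fun x => G (upd x i b) - G (upd x i a).

(** The fundamental theorem of calculus along one edge. Inner points of [[a, b]] are inner points of
    [[0, 1]], and continuity is enough at the end points. *)
Lemma coord_diff_integral i a b F P x : 0 <= a -> a < b -> b <= 1 ->
  continuous F -> continuous P -> is_partial i F P -> cube x ->
  coord_diff i a b F x = coord_integral i a b P x.
Proof.
move=> a0 ab b1 cF cP FP Dx.
have cFx := @continuous_comp_upd _ _ _ x i cF.
have cPx := @continuous_comp_upd _ _ _ x i cP.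
have dF t : a < t < b -> is_derive t 1 (fun t => F (upd x i t)) (P (upd x i t)).
  move=> /andP[a_t t_b].
  have t01 : 0 < t < 1 by apply/andP; split; lra.
  have Dt : cube (upd x i t) by apply: cube_upd => //; case/andP: t01 => ? ?; rewrite !ltW.
  have := is_partial_is_derive FP Dt.
  rewrite updE eqxx => /(_ t01); congr (is_derive _ _ _ _).
  by apply/funext => u; rewrite upd_upd.
rewrite /coord_integral (integral_segment_derive ab _ _ dF)//; exact: continuous_subspaceT.
Qed.

Definition coord_integrals s (a b : 'I_n -> R) G :=
  foldr (fun i => coord_integral i (a i) (b i)) G s.

Lemma continuous_coord_integrals s a b G : continuous G -> continuous (coord_integrals s a b G).
Proof. by move=> cG; elim: s => //= i s; exact: continuous_coord_integral. Qed.

Lemma coord_integrals_perm s s' a b G : perm_eq s s' -> continuous G ->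
  coord_integrals s a b G = coord_integrals s' a b G.
Proof.
apply: (@foldr_perm _ _ (fun F : V -> R => continuous F)) => [i y|i j y ij cy].
  exact: continuous_coord_integral.
by rewrite coord_integralC.
Qed.

Lemma coord_integrals_congr s a b F G x : (forall i, 0 <= a i) -> (forall i, b i <= 1) ->
  (forall y, cube y -> F y = G y) -> cube x ->
  coord_integrals s a b F x = coord_integrals s a b G x.
Proof.
move=> a0 b1 FG; elim: s x => [|i s IHs] x Dx /=; first exact: FG.
apply: eq_Rintegral => u; rewrite inE/= in_itv/= => /andP[au ub]; apply: IHs.
by apply: cube_upd => //; rewrite (le_trans (a0 i))// (le_trans ub).
Qed.

Lemma coord_diff_integrals i s a b c d G : i \notin s -> continuous G ->
  coord_diff i c d (coord_integrals s a b G) = coord_integrals s a b (coord_diff i c d G).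
Proof.
move=> + cG; elim: s => // j s IHs; rewrite inE negb_or => /andP[ij /IHs E].
have Ej F : coord_integrals (j :: s) a b F = coord_integral j (a j) (b j) (coord_integrals s a b F).
  by [].
rewrite !Ej -E; apply/funext => x; rewrite /coord_diff !coord_integral_upd 1?eq_sym//.
have cI t : continuous (fun y => coord_integrals s a b G (upd y i t)).
  move=> y; apply: (@cvg_comp _ _ _ (fun y => upd y i t) (coord_integrals s a b G)).
    apply: (@continuous_upd _ _ _ id i (cst t)) => z; [exact: cvg_id|exact: cst_continuous].
  exact: continuous_coord_integrals.
have intI t := @integrable_coord _ _ j (a j) (b j) _ x (cI t).
by rewrite -(RintegralB _ (intI d) (intI c)).
Qed.

(** The fundamental theorem over a box. By induction, the difference in direction [i] passes under
    the integrals of the other directions, where it becomes an integral itself. *)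
Lemma coord_diffs_partials f s (a b : 'I_n -> R) x :
  (forall i, 0 <= a i) -> (forall i, a i < b i) -> (forall i, b i <= 1) -> uniq s ->
  partials_exist cube s f ->
  (forall p : nat, {within cube, continuous (partials cube (drop p s) f)}) -> cube x ->
  foldr (fun i => coord_diff i (a i) (b i)) f s x =
  coord_integrals s a b (partials cube s f \o clamp) x.
Proof.
move=> a0 ab b1; elim: s x => [|i s IHs] x /=.
  by move=> _ _ _ Dx; rewrite clamp_id.
move=> /andP[iNs us] [ds di] cs Dx.
have cs' (p : nat) : {within cube, continuous (partials cube (drop p s) f)} := cs p.+1.
have cG : continuous (partials cube s f \o clamp).
  by apply: continuous_comp_clamp; have := cs' 0%N; rewrite drop0.
have cP : continuous (partial cube i (partials cube s f) \o clamp).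
  by apply: continuous_comp_clamp; exact: (cs 0%N).
have b01 j : 0 <= b j <= 1 by rewrite b1 (le_trans (a0 j))// ltW.
have a01 j : 0 <= a j <= 1 by rewrite a0 (le_trans (ltW (ab j))).
rewrite /coord_diff !IHs//; try exact: cube_upd.
rewrite -[LHS]/(coord_diff i (a i) (b i) (coord_integrals s a b _) x).
rewrite coord_diff_integrals//.
rewrite -[RHS]/(coord_integrals (i :: s) a b _ x).
(* Fubini makes the integral in direction [i] the innermost one, matching the difference on the
   left. *)
have si : perm_eq (i :: s) (rcons s i) by rewrite perm_sym perm_rcons.
rewrite (coord_integrals_perm _ _ si cP).
rewrite /coord_integrals foldr_rcons; apply: coord_integrals_congr => // y Dy.
apply: coord_diff_integral => //.
apply: (@is_partial_congr _ (partials cube s f) _ (partial cube i (partials cube s f))).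
- by apply/is_partialP => z Dz; split => //; exact: di.
- by move=> z Dz; rewrite /= clamp_id.
- by move=> z Dz; rewrite /= clamp_id.
Qed.

(** The intermediate derivatives of the induction over [support_seq r] are thus among those whose
    continuity [smooth r] provides. *)
Lemma support_seq_suffix (r : {ffun 'I_n -> bool}) (p : nat) :
  exists2 t : {ffun 'I_n -> bool}, (forall i, t i <= r i)%N &
    drop p (support_seq r) = support_seq t.
Proof.
exists [ffun i => i \in drop p (support_seq r)].
  move=> i; rewrite ffunE; case: (boolP (i \in _)) => // /mem_drop.
  by rewrite mem_filter => /andP[->].
have /subseq_uniqP : subseq (drop p (support_seq r)) (enum 'I_n).
  by apply: subseq_trans (drop_subseq _ _) (filter_subseq _ _).
by move=> /(_ (enum_uniq _)) {1}->; apply: eq_filter => i; rewrite ffunE.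
Qed.

Lemma support_seq_uniq (r : {ffun 'I_n -> bool}) : uniq (support_seq r).
Proof. exact/filter_uniq/enum_uniq. Qed.

End Partials.

(** * Iterated primitives of a continuous function *)

Section Primitives.
Context {R : realType} {n : nat}.
Local Notation mu := (@lebesgue_measure R).
Local Notation V := 'rV[R]_n.
Implicit Types (x y : V) (i j k : 'I_n) (F G P : V -> R) (s : seq 'I_n).

(* Starting below [0] makes the primitive differentiable at the boundary of the
   cube, and truncating the upper bound makes it continuous everywhere. *)
Definition coord_primitive i G : V -> R :=
  fun x => coord_integral i (-1) (Num.max (x ord0 i) (- 2^-1)) G x.

Lemma continuous_coord_primitive i G : continuous G -> continuous (coord_primitive i G).
Proof.
move=> cG; apply: (@continuous_integral_upper _ _ (fun x u => G (upd x i u))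
  (fun x => Num.max (x ord0 i) (- 2^-1))) => [y|y|].
- apply: (@continuous_max _ _ (fun y => y ord0 i) (cst (- 2^-1))).
    exact: continuous_coord.
  exact: cst_continuous.
- by rewrite lt_max; apply/orP; right; lra.
- exact: continuous_comp_upd_pair.
Qed.

Lemma is_partial_coord_primitive i G : continuous G ->
  is_partial i (coord_primitive i G) G.
Proof.
move=> cG; apply: is_derive_is_partial => x Dx.
have /andP[x0 _] := Dx i.
have xN1 : -1 < x ord0 i by lra.
have := derive_primitive xN1 (@continuous_comp_upd _ _ _ x i cG).
rewrite upd_id; apply: near_eq_is_derive.
(* Near a coordinate of a point of the cube the truncation at [- 2^-1] is inactive. *)
have : \forall t \near x ord0 i, - 2^-1 < t by apply: lt_nbhsr; lra.
apply: filterS => t t0; rewrite /coord_primitive updE eqxx (max_l (ltW t0)).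
by rewrite coord_integral_upd_id.
Qed.

Lemma coord_primitiveC i j G : i != j -> continuous G ->
  coord_primitive i (coord_primitive j G) = coord_primitive j (coord_primitive i G).
Proof.
move=> ij cG; apply/funext => x; rewrite /coord_primitive /coord_integral.
under eq_Rintegral do rewrite updE eq_sym (negbTE ij).
under [RHS]eq_Rintegral do rewrite updE (negbTE ij).
exact: integral_upd_swap.
Qed.

Definition coord_primitives s G := foldr coord_primitive G s.

Lemma continuous_coord_primitives s G : continuous G -> continuous (coord_primitives s G).
Proof. by move=> cG; elim: s => //= i s; exact: continuous_coord_primitive. Qed.

Lemma coord_primitives_perm s s' G : perm_eq s s' -> continuous G ->
  coord_primitives s G = coord_primitives s' G.
Proof.
apply: (@foldr_perm _ _ (fun F : V -> R => continuous F)) => [i y|i j y ij cy].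
  exact: continuous_coord_primitive.
by rewrite coord_primitiveC.
Qed.

(** The derivative applied first is that of the last index of [s]; the reversal makes it meet the
    outermost primitive. *)
Lemma partials_coord_primitives s G : continuous G ->
  partials_exist cube s (coord_primitives (rev s) G) /\
  (forall x, cube x -> partials cube s (coord_primitives (rev s) G) x = G x).
Proof.
elim: s G => [|i s IHs] G cG //=.
rewrite rev_cons /coord_primitives foldr_rcons.
have [ds Es] := IHs _ (@continuous_coord_primitive i G cG).
have /is_partialP H : is_partial i
    (partials cube s (coord_primitives (rev s) (coord_primitive i G))) G.
  apply: (is_partial_congr (is_partial_coord_primitive i cG)) => // y Dy.
  by rewrite Es.
by split; [split => // x /H[]|move=> x /H[]].
Qed.

(** Primitives commute, so those in the directions of [t] may be taken last. The derivative of order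
    [t] removes them and leaves the primitive in the remaining directions of [r]. *)
Lemma smooth_coord_primitives (r : {ffun 'I_n -> bool}) G : continuous G ->
  smooth r (coord_primitives (support_seq r) G) /\
  (forall x, cube x ->
    mixed_deriv cube r (coord_primitives (support_seq r) G) x = G x).
Proof.
move=> cG.
have E (t : {ffun 'I_n -> bool}) : (forall i, t i <= r i)%N ->
    exists2 s, perm_eq (support_seq r) (rev (support_seq t) ++ s) &
      (forall i, i \in s = r i && ~~ t i).
  move=> tr; exists [seq i <- support_seq r | ~~ t i].
    have -> : support_seq t = [seq i <- support_seq r | t i].
      rewrite -filter_predI; apply: eq_filter => i /=.
      by have := tr i; case: (t i) (r i) => [] [].
    rewrite perm_sym; set S1 := [seq i <- _ | t i].
    apply: (@perm_trans _ (S1 ++ [seq i <- support_seq r | ~~ t i])).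
      by rewrite perm_cat2r perm_rev.
    by rewrite /S1 perm_filterC.
  by move=> i; rewrite mem_filter mem_filter mem_enum andbT andbC.
(* On the cube [G'] will be the derivative of order [t]. *)
have S (t : {ffun 'I_n -> bool}) : (forall i, t i <= r i)%N ->
    exists2 G', continuous G' &
      [/\ coord_primitives (support_seq r) G = coord_primitives (rev (support_seq t)) G' &
       t = r -> G' = G].
  move=> /E[s ps sE]; exists (coord_primitives s G).
    exact: continuous_coord_primitives.
  split; first by rewrite (coord_primitives_perm ps)// /coord_primitives foldr_cat.
  move=> tr; suff -> : s = [::] by [].
  case: s {ps} sE => // i s /(_ i); rewrite mem_head tr.
  by case: (r i).
split=> [t tr|].
  have [G' cG' [-> _]] := S t tr.
  have [? H] := partials_coord_primitives (support_seq t) cG'.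
  split => //; apply: (@subspace_eq_continuous _ _ _ G').
    by move=> x; rewrite inE => Dx; rewrite /from_subspace /= -H.
  exact: continuous_subspaceT.
move=> x Dx; have [|G' cG' [-> GE]] := S r; first by [].
by rewrite /mixed_deriv (partials_coord_primitives _ cG').2// GE.
Qed.

End Primitives.

(** * The derivative of the spline as an iterated mean *)

Section BlockPolynomial.
Context {R : realType} {n : nat}.
Local Notation mu := (@lebesgue_measure R).
Local Notation V := 'rV[R]_n.
Implicit Types (x y : V) (i k : 'I_n) (f F G P : V -> R) (s : seq 'I_n).
Implicit Types (r l : {ffun 'I_n -> bool}) (m j : 'I_n -> nat).
Implicit Types (w c : 'I_n -> bool -> R).

Definition slope (b : bool) (p : nat) : R := if b then p%:R else - p%:R.

Lemma hatD b p q (t u : R) : hat b p q (t + u) = t * slope b p + hat b p q u.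
Proof. by rewrite /hat /slope; case: b; ring. Qed.

Lemma derive_affine F (v x : V) D :
  (forall h, F (h *: v + x) - F x = h * D) -> 'D_v F x = D.
Proof.
move=> FD; apply: cvg_lim; first exact: Rhausdorff.
apply: (cvg_trans (near_eq_cvg (f := cst D) _)); last exact: cvg_cst.
near=> h; rewrite /= FD /GRing.scale/= mulKf//.
by near: h; exact: nbhs_dnbhs_neq.
Unshelve. all: by end_near. Qed.

(** Every summand is affine in each coordinate, so a derivative in direction [i] only replaces the
    factor [i] by its slope. Since [s] has no repetition, this factor is still a [hat] at that
    moment. *)
Lemma partials_block_poly m j f s : uniq s ->
  partials setT s (block_poly m j f) = fun x =>
    \sum_(l : {ffun 'I_n -> bool}) f (node m (fun i => j i + l i)%N) *
      \prod_(i < n) (if i \in s then slope (l i) (m i)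
                     else hat (l i) (m i) (j i) (x ord0 i)).
Proof.
elim: s => [_|i s IHs /= /andP[iNs us]].
  by apply/funext => x; apply: eq_bigr.
rewrite (IHs us); apply/funext => x; rewrite partial_setT; apply: derive_affine => h.
rewrite -sumrB mulr_sumr; apply: eq_bigr => l _.
rewrite -mulrBr mulrCA; congr (_ * _).
rewrite [X in X - _ = _](bigD1 i)//= [X in _ - X = _](bigD1 i)//=.
rewrite [X in _ = _ * X](bigD1 i)//= (negbTE iNs) mem_head delta_upd updE eqxx hatD.
have E y : (forall k, k != i -> y ord0 k = x ord0 k) ->
  \prod_(k < n | k != i) (if k \in s then slope (l k) (m k)
    else hat (l k) (m k) (j k) (y ord0 k)) =
  \prod_(k < n | k != i) (if k \in i :: s then slope (l k) (m k)
    else hat (l k) (m k) (j k) (x ord0 k)).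
  by move=> yx; apply: eq_bigr => k ki; rewrite inE (negbTE ki)/= yx.
rewrite !E//; first by ring.
by move=> k ki; rewrite updE (negbTE ki).
Qed.

Definition coord_sum w c i G : V -> R :=
  fun x => \sum_(b : bool) w i b * G (upd x i (c i b)).

Lemma coord_sumC w c i k G : i != k ->
  coord_sum w c i (coord_sum w c k G) = coord_sum w c k (coord_sum w c i G).
Proof.
move=> ik; apply/funext => x; rewrite /coord_sum.
under eq_bigr do rewrite mulr_sumr.
under [RHS]eq_bigr do rewrite mulr_sumr.
rewrite exchange_big; apply: eq_bigr => b _; apply: eq_bigr => b' _.
by rewrite mulrCA upd_comm.
Qed.

(** As [Y b] ignores the value at [i], the factor [(~~ l i)%:R] keeps one representative of each
    choice outside [i]. *)
Lemma sum_ffun_split i (w : bool -> R) (Y : bool -> {ffun 'I_n -> bool} -> R) :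
  (forall b l l', (forall k, k != i -> l k = l' k) -> Y b l = Y b l') ->
  \sum_(l : {ffun 'I_n -> bool}) w (l i) * Y (l i) l =
  \sum_(b : bool) w b * \sum_(l : {ffun 'I_n -> bool}) (~~ l i)%:R * Y b l.
Proof.
move=> Yi; rewrite big_bool.
have E b : \sum_(l : {ffun 'I_n -> bool}) (~~ l i)%:R * Y b l =
    \sum_(l : {ffun 'I_n -> bool} | ~~ l i) Y b l.
  by rewrite [RHS]big_mkcond; apply: eq_bigr => l _; case: (l i); rewrite ?mul0r ?mul1r.
rewrite !E !mulr_sumr (bigID (fun l : {ffun 'I_n -> bool} => l i))/=; congr (_ + _).
  (* Flipping the value at [i] matches the two halves of the sum. *)
  pose tog l : {ffun 'I_n -> bool} := [ffun k => (k == i) (+) l k].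
  have togK : involutive tog by move=> l; apply/ffunP => k; rewrite !ffunE addbA addbb.
  rewrite (reindex_inj (inv_inj togK))/=; apply: eq_big => l.
    by rewrite ffunE eqxx.
  rewrite ffunE eqxx => /= ->; congr (_ * _); apply: Yi => k ki.
  by rewrite ffunE (negbTE ki).
by apply: eq_bigr => l /negbTE ->.
Qed.

(** Composing two-node sums expands into a tensor sum. Outside [s] the factor [(~~ l i)%:R] forces
    [l i = false], so each choice on [s] is counted once. *)
Lemma foldr_coord_sum w c F s x : uniq s ->
  foldr (coord_sum w c) F s x =
  \sum_(l : {ffun 'I_n -> bool})
    (\prod_(i < n) (if i \in s then w i (l i) else (~~ l i)%:R)) *
    F (\row_i (if i \in s then c i (l i) else x ord0 i)).
Proof.
elim: s x => [|i s IHs] x /=.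
  move=> _; rewrite (bigD1 [ffun=> false])//= [X in _ + X]big1 => [|l l0].
    rewrite addr0 big1 ?mul1r => [|i _]; last by rewrite ffunE.
    by congr F; apply/rowP => i; rewrite mxE.
  have [i li] : exists i, l i.
    apply/existsP; apply: contraNT l0; rewrite negb_exists => /forallP l0.
    by apply/eqP/ffunP => i; rewrite ffunE; apply/negbTE.
  by rewrite (bigD1 i)//= li !mul0r.
move=> /andP[iNs us].
pose Y b (l : {ffun 'I_n -> bool}) :=
  (\prod_(k < n | k != i) (if k \in s then w k (l k) else (~~ l k)%:R)) *
  F (\row_k (if k \in s then c k (l k) else upd x i (c i b) ord0 k)).
transitivity (\sum_(b : bool) w i b * \sum_(l : {ffun 'I_n -> bool}) (~~ l i)%:R * Y b l).
  apply: eq_bigr => b _; rewrite (IHs _ us); congr (_ * _); apply: eq_bigr => l _.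
  by rewrite (bigD1 i)//= (negbTE iNs) mulrA.
rewrite -sum_ffun_split => [|b l l' ll'].
  apply: eq_bigr => l _; rewrite [in RHS](bigD1 i)//= mem_head -mulrA; congr (_ * (_ * _)).
    by apply: eq_bigr => k ki; rewrite inE (negbTE ki).
  congr F; apply/rowP => k; rewrite !mxE inE.
  by have [->|ki] := eqVneq k i; rewrite ?(negbTE iNs).
congr (_ * F _).
  by apply: eq_bigr => k ki; rewrite ll'.
apply/rowP => k; rewrite !mxE; case: ifP => // ks; rewrite ll'//.
by apply: contraNneq iNs => <-.
Qed.

(** The factor [m i] is the inverse length of the edge and the two hat values sum to [1], so both
    branches are averages. The point [x0] is a separate parameter because it stays fixed while
    composed means alter the argument. *)
Definition block_mean m r j x0 i G : V -> R :=
  if r i then fun x => (m i)%:R *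
    coord_integral i ((j i)%:R / (m i)%:R) ((j i).+1%:R / (m i)%:R) G x
  else coord_sum (fun i b => hat b (m i) (j i) (x0 ord0 i))
    (fun i b => (j i + b)%:R / (m i)%:R) i G.

(** The integrals are innermost: acting directly on the mixed derivative, they give back differences
    of [f], which the node sums then combine. *)
Definition block_means m r j x0 G :=
  foldr (block_mean m r j x0) G ([seq i <- enum 'I_n | ~~ r i] ++ support_seq r).

Lemma continuous_block_mean m r j x0 i G : continuous G ->
  continuous (block_mean m r j x0 i G).
Proof.
move=> cG; rewrite /block_mean; case: (r i).
  by apply: continuous_scale; exact: continuous_coord_integral.
have cGb b : continuous (fun x => hat b (m i) (j i) (x0 ord0 i) *
    G (upd x i ((j i + b)%:R / (m i)%:R))).
  apply: continuous_scale => y.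
  apply: (@cvg_comp _ _ _ (fun y => upd y i _) G); last exact: cG.
  apply: (@continuous_upd _ _ _ id i (cst _)) => z; [exact: cvg_id|exact: cst_continuous].
rewrite /coord_sum (_ : (fun _ => _) = (fun x =>
    hat true (m i) (j i) (x0 ord0 i) * G (upd x i ((j i + true)%:R / (m i)%:R)) +
    hat false (m i) (j i) (x0 ord0 i) * G (upd x i ((j i + false)%:R / (m i)%:R)))).
  exact: continuous_add.
by apply/funext => x; rewrite big_bool.
Qed.

Section Cell.
Variables (m j : 'I_n -> nat).
Hypothesis jm : forall i, (j i < m i)%N.

Let m_gt0 i : 0 < (m i)%:R :> R.
Proof. by rewrite ltr0n (leq_trans _ (jm i)). Qed.

Lemma cell_node_ge0 i : 0 <= (j i)%:R / (m i)%:R :> R.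
Proof. by rewrite divr_ge0. Qed.

Lemma cell_node_le1 i : (j i).+1%:R / (m i)%:R <= 1 :> R.
Proof. by rewrite ler_pdivrMr// mul1r ler_nat. Qed.

Lemma cell_node_lt i : (j i)%:R / (m i)%:R < (j i).+1%:R / (m i)%:R :> R.
Proof. by rewrite ltr_pM2r ?invr_gt0// ltr_nat. Qed.

Lemma cell_node01 i (b : bool) : 0 <= ((j i + b)%:R / (m i)%:R : R) <= 1.
Proof.
rewrite divr_ge0//= (le_trans _ (cell_node_le1 i))// ler_pM2r ?invr_gt0//.
by rewrite ler_nat -addn1 leq_add2l leq_b1.
Qed.

Lemma block_mean_congr r x0 i F G : (forall y, cube y -> F y = G y) ->
  forall y, cube y -> block_mean m r j x0 i F y = block_mean m r j x0 i G y.
Proof.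
move=> FG y Dy; rewrite /block_mean; case: (r i).
  congr (_ * _); apply: eq_Rintegral => u; rewrite inE/= in_itv/= => /andP[au ub].
  apply: FG; apply: cube_upd => //.
  by rewrite (le_trans (cell_node_ge0 i))// (le_trans ub)// cell_node_le1.
by apply: eq_bigr => b _; rewrite FG//; apply: cube_upd => //; exact: cell_node01.
Qed.

Lemma foldr_block_mean_congr r x0 s F G : (forall y, cube y -> F y = G y) ->
  forall y, cube y ->
  foldr (block_mean m r j x0) F s y = foldr (block_mean m r j x0) G s y.
Proof. by move=> FG; elim: s => //= i s; exact: block_mean_congr. Qed.

Lemma foldr_block_mean_support r x0 s G : all r s -> continuous G ->
  foldr (block_mean m r j x0) G s = fun x => (\prod_(i <- s) (m i)%:R) *
    coord_integrals s (fun i => (j i)%:R / (m i)%:R) (fun i => (j i).+1%:R / (m i)%:R) G x.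
Proof.
move=> + cG; elim: s => [_|i s IHs /= /andP[ri rs]].
  by apply/funext => x; rewrite big_nil mul1r.
rewrite IHs// /block_mean ri; apply/funext => x; rewrite big_cons -mulrA; congr (_ * _).
rewrite /coord_integral RintegralZl//.
by apply: integrable_coord; exact: continuous_coord_integrals.
Qed.

(** The derived polynomial is a composition of two-node sums. Where [r i] holds, the weights are the
    slopes [m i] and [- m i], so the sum is [m i] times a difference of [f]; the fundamental theorem
    turns these differences into integrals of the mixed derivative. *)
Lemma mixed_deriv_block_poly r f x : smooth r f -> cube x ->
  mixed_deriv setT r (block_poly m j f) x =
  block_means m r j x (mixed_deriv cube r f \o clamp) x.
Proof.
move=> sf Dx; rewrite /mixed_deriv partials_block_poly ?support_seq_uniq//.
pose w i b := if r i then slope b (m i) else hat b (m i) (j i) (x ord0 i).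
pose c i (b : bool) : R := (j i + b)%:R / (m i)%:R.
transitivity (foldr (coord_sum w c) f (enum 'I_n) x).
  rewrite foldr_coord_sum ?enum_uniq//; apply: eq_bigr => l _; rewrite mulrC; congr (_ * _).
    apply: eq_bigr => i _; rewrite mem_enum mem_filter mem_enum andbT /w inE.
    by [].
  by congr f; apply/rowP => i; rewrite !mxE mem_enum.
(* The directions of [r] are moved innermost, next to [f]. *)
have ps : perm_eq (enum 'I_n) ([seq i <- enum 'I_n | ~~ r i] ++ support_seq r).
  by rewrite perm_sym perm_catC perm_filterC.
rewrite (@foldr_perm _ _ xpredT _ _ _ _ _ _ ps)//; last first.
  by move=> i k G ik _; rewrite coord_sumC.
rewrite /block_means !foldr_cat.
have E s F : all [pred i | ~~ r i] s ->
    foldr (coord_sum w c) F s = foldr (block_mean m r j x) F s.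
  elim: s => //= i s IHs /andP[/negbTE ri rs]; rewrite IHs// /block_mean ri.
  by apply/funext => y; apply: eq_bigr => b _; rewrite /w ri.
rewrite E ?filter_all//; apply: foldr_block_mean_congr => // y Dy.
rewrite foldr_block_mean_support ?filter_all//; last first.
  by apply: continuous_comp_clamp; have [] := sf r (fun i => leqnn _).
rewrite -coord_diffs_partials ?support_seq_uniq//.
- have : all r (support_seq r) by exact: filter_all.
  move: (support_seq r) y {Dy} => s; elim: s => [|i s IHs] y /=.
    by rewrite big_nil mul1r.
  move=> /andP[ri rs]; rewrite big_cons /coord_sum big_bool /w ri !IHs// /c /slope.
  by rewrite addn1 addn0 /coord_diff mulNr mulrBr !mulrA.
- exact: cell_node_lt.
- exact: cell_node_le1.
- by have [] := sf r (fun i => leqnn _).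
- move=> p; have [t tr ->] := support_seq_suffix r p.
  by have [] := sf t tr.
Qed.

End Cell.

End BlockPolynomial.

(** * Reflecting and folding a segment *)

Section SegmentReflection.
Context {R : realType}.
Local Notation mu := (@lebesgue_measure R).
Implicit Types (a b t : R) (f : R -> R).

(** If [P] is a primitive of [f], then [u |-> - P (t - u)] is one of [f (t - u)]. *)
Lemma integral_segment_reflect f a b t : a <= b -> continuous f ->
  \int[mu]_(u in `[a, b]) f (t - u) = \int[mu]_(u in `[t - b, t - a]) f u.
Proof.
move=> + cf; rewrite le_eqVlt => /predU1P[->|ab].
  by rewrite !set_itv1 !Rintegral_set1.
(* Starting the primitive strictly below [t - b] makes it differentiable at all the points
   [t - u]. *)
pose A := t - b - 1.
pose P s := \int[mu]_(u in `[A, s]) f u.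
have ctu : continuous (fun u : R => t - u).
  by move=> u; apply: cvgB; [exact: cvg_cst|exact: cvg_id].
have cft : continuous (fun u => f (t - u)).
  by move=> u; apply: (@cvg_comp _ _ _ (fun u => t - u) f); [exact: ctu|exact: cf].
have dP u : a <= u <= b -> is_derive u 1 (fun u => - P (t - u)) (f (t - u)).
  move=> /andP[au ub].
  have Atu : A < t - u by rewrite /A; lra.
  have dPt := derive_primitive Atu cf.
  have dtu : is_derive u (1 : R) (fun u : R => t - u) (- 1).
    by rewrite -[X in is_derive _ _ _ X]add0r; apply: is_deriveB.
  have dc := @is_derive1_comp _ P (fun u : R => t - u) _ _ _ dPt dtu.
  by have := is_deriveN dc; rewrite mulrN1 opprK.
have cPt : {within `[a, b], continuous (fun u => - P (t - u))}.
  apply: derivable_within_continuous => u; rewrite in_itv/= => abu.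
  by case: (dP u abu).
have dP' u : a < u < b -> is_derive u 1 (fun u => - P (t - u)) (f (t - u)).
  by move=> /andP[au ub]; apply: dP; rewrite !ltW.
have cftw : {within `[a, b], continuous (fun u => f (t - u))}.
  exact: continuous_subspaceT.
rewrite (integral_segment_derive ab cftw cPt dP') opprK addrC.
have Atb : A <= t - b by rewrite /A; lra.
have tba : t - b <= t - a by lra.
by rewrite /P (integral_segment_cat Atb tba cf) addrAC subrr add0r.
Qed.

(* Folding the segment at [t] yields two segments starting at [0], of total
   length [b - a]; the second one is moved to the end of the first one, which
   only increases the integral. *)
Lemma integral_segment_fold f a b t : a <= t <= b -> continuous f ->
  (forall u v, `|u| <= `|v| -> f u <= f v) ->
  \int[mu]_(u in `[a, b]) f (t - u) <= \int[mu]_(u in `[0, b - a]) f u.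
Proof.
move=> /andP[at_ tb] cf fm.
have tb0 : t - b <= 0 by lra.
have ta0 : 0 <= t - a by lra.
have tab : t - a <= b - a by lra.
rewrite integral_segment_reflect ?(le_trans at_)//.
rewrite (integral_segment_cat tb0 ta0 cf) (integral_segment_cat ta0 tab cf).
rewrite addrC lerD2l.
(* The map [u |-> t - a - u] carries [[t - b, 0]] onto [[t - a, b - a]] and increases the absolute
   value by [t - a]. *)
have := integral_segment_reflect (t - a) tb0 cf.
rewrite subr0 (_ : t - a - (t - b) = b - a); last by ring.
move=> <-; apply: le_Rintegral => //.
- exact/integrable_segment/continuous_subspaceT.
- apply: integrable_segment; apply: continuous_subspaceT => u.
  apply: (@cvg_comp _ _ _ (fun u => t - a - u) f); last exact: cf.
  by apply: cvgB; [exact: cvg_cst|exact: cvg_id].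
- move=> u; rewrite /= in_itv/= => /andP[_ u0]; apply: fm.
  by rewrite ler0_norm// ger0_norm; lra.
Qed.

End SegmentReflection.

(** * Bounding the mean in a single direction *)

Section Majorant.
Context {R : realType} {n : nat}.
Local Notation mu := (@lebesgue_measure R).
Local Notation V := 'rV[R]_n.
Implicit Types (x y z : V) (i k : 'I_n) (F G B Phi : V -> R) (s : seq 'I_n).
Variables (r : {ffun 'I_n -> bool}) (m : 'I_n -> nat).

(** Evenness in each coordinate and monotonicity on the orthant in a single condition. *)
Definition norm_homo Phi := forall x y,
  (forall k, `|x ord0 k| <= `|y ord0 k|) -> Phi x <= Phi y.

(** Only nonnegative values of the coordinate are compared, since a monotone function of its
    absolute value is in general not concave across [0]. *)
Definition half_concave k Phi := forall x p q t, 0 <= p -> 0 <= q -> 0 <= t <= 1 ->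
  t * Phi (upd x k p) + (1 - t) * Phi (upd x k q) <= Phi (upd x k (t * p + (1 - t) * q)).

(** The mean of [fun x => Phi (x0 - x)] in the worst position of [x0] on its edge: an end point if
    [r i], the midpoint otherwise. *)
Definition extremal_mean i Phi : V -> R :=
  if r i then fun z => (m i)%:R * coord_integral i 0 (m i)%:R^-1 Phi z
  else fun z => Phi (upd z i (2 * (m i)%:R)^-1).

Lemma continuous_extremal_mean i Phi : continuous Phi -> continuous (extremal_mean i Phi).
Proof.
move=> cP; rewrite /extremal_mean; case: (r i).
  by apply: continuous_scale; exact: continuous_coord_integral.
move=> y; apply: (@cvg_comp _ _ _ (fun y => upd y i _) Phi); last exact: cP.
apply: (@continuous_upd _ _ _ id i (cst _)) => z; [exact: cvg_id|exact: cst_continuous].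
Qed.

Lemma norm_homo_upd Phi x y i p q : norm_homo Phi ->
  (forall k, `|x ord0 k| <= `|y ord0 k|) -> `|p| <= `|q| ->
  Phi (upd x i p) <= Phi (upd y i q).
Proof. by move=> hP xy pq; apply: hP => k; rewrite !updE; case: eqP. Qed.

Lemma norm_homo_eq Phi x y : norm_homo Phi ->
  (forall k, `|x ord0 k| = `|y ord0 k|) -> Phi x = Phi y.
Proof. by move=> hP xy; apply: le_anti; rewrite !hP// => k; rewrite xy. Qed.

Lemma norm_homo_extremal_mean i Phi : continuous Phi -> norm_homo Phi ->
  norm_homo (extremal_mean i Phi).
Proof.
move=> cP hP x y xy; rewrite /extremal_mean; case: (r i); last exact: norm_homo_upd.
rewrite ler_wpM2l//; apply: le_Rintegral => //; try exact: integrable_coord.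
by move=> u _; exact: norm_homo_upd.
Qed.

Lemma half_concave_extremal_mean i k Phi : i != k -> continuous Phi ->
  half_concave k Phi -> half_concave k (extremal_mean i Phi).
Proof.
move=> ik cP kP x p q t p0 q0 t01; rewrite /extremal_mean; case: (r i); last first.
  by rewrite ![upd (upd x k _) i _]upd_comm 1?eq_sym//; exact: kP.
rewrite [t * _]mulrCA [(1 - t) * _]mulrCA -mulrDr ler_wpM2l//.
rewrite !coord_integral_upd// /coord_integral.
have iP v : continuous (fun y => Phi (upd y k v)).
  move=> y; apply: (@cvg_comp _ _ _ (fun y => upd y k v) Phi); last exact: cP.
  apply: (@continuous_upd _ _ _ id k (cst _)) => z; [exact: cvg_id|exact: cst_continuous].
have cs c v : continuous (fun y => c * Phi (upd y k v)) by exact: continuous_scale.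
have intP v := @integrable_coord _ _ i 0 (m i)%:R^-1 _ x (iP v).
have intc c v := @integrable_coord _ _ i 0 (m i)%:R^-1 _ x (cs c v).
have cD : continuous (fun y => t * Phi (upd y k p) + (1 - t) * Phi (upd y k q)).
  exact: continuous_add.
have intD := @integrable_coord _ _ i 0 (m i)%:R^-1 _ x cD.
rewrite -(RintegralZl _ _ (intP p))// -(RintegralZl _ _ (intP q))//.
rewrite -(RintegralD _ (intc t p) (intc (1 - t) q))//.
by apply: (le_Rintegral _ intD (intP _)) => // u _; exact: kP.
Qed.

Section Cell.
Variables (j : 'I_n -> nat) (x0 : V).
Hypothesis jm : forall i, (j i < m i)%N.
Hypothesis jx : forall i, (j i)%:R / (m i)%:R <= x0 ord0 i <= (j i).+1%:R / (m i)%:R.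

Let m_gt0 i : 0 < (m i)%:R :> R.
Proof. by rewrite ltr0n (leq_trans _ (jm i)). Qed.

Let cellB i : (j i).+1%:R / (m i)%:R - (j i)%:R / (m i)%:R = (m i)%:R^-1 :> R.
Proof. by rewrite -mulrBl -natrB// subSnn mul1r. Qed.

Let hat_false i : hat false (m i) (j i) (x0 ord0 i) =
  (m i)%:R * ((j i).+1%:R / (m i)%:R - x0 ord0 i).
Proof. by []. Qed.

Lemma hat_ge0 i b : 0 <= hat b (m i) (j i) (x0 ord0 i).
Proof.
have /andP[jx1 jx2] := jx i.
have m0 := m_gt0 i.
case: b; last by rewrite mulr_ge0 ?subr_ge0// ltW.
have : (m i)%:R * ((j i).+1%:R / (m i)%:R - x0 ord0 i) <= (m i)%:R / (m i)%:R.
  by rewrite ler_pM2l//; have := cellB i; move: jx1; lra.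
by rewrite mulfV ?lt0r_neq0// /hat subr_ge0.
Qed.

Lemma hat_sum i : \sum_(b : bool) hat b (m i) (j i) (x0 ord0 i) = 1.
Proof. by rewrite big_bool /hat/= subrK. Qed.

Local Notation bmean := (block_mean m r j x0).

Lemma block_mean_le i F G y : continuous F -> continuous G ->
  (forall x, F x <= G x) -> bmean i F y <= bmean i G y.
Proof.
move=> cF cG FG; rewrite /block_mean; case: (r i).
  by rewrite ler_wpM2l//; apply: le_Rintegral => //; exact: integrable_coord.
by apply: ler_sum => b _; rewrite ler_wpM2l// hat_ge0.
Qed.

(** The total weight of a mean is [1], so constants are preserved. *)
Lemma block_mean_affine i B y c e : continuous B ->
  bmean i (fun x => c + e * B x) y = c + e * bmean i B y.
Proof.
move=> cB; rewrite /block_mean; case: (r i); last first.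
  rewrite /coord_sum -[c in RHS]mul1r -(hat_sum i) mulr_suml mulr_sumr -big_split/=.
  by apply: eq_bigr => b _; ring.
have ab : (j i)%:R / (m i)%:R <= (j i).+1%:R / (m i)%:R :> R.
  by rewrite -subr_ge0 cellB invr_ge0 ltW.
have intB := @integrable_coord _ _ i ((j i)%:R / (m i)%:R) ((j i).+1%:R / (m i)%:R) _ y cB.
have inteB := @integrable_coord _ _ i ((j i)%:R / (m i)%:R) ((j i).+1%:R / (m i)%:R) _ y
  (@continuous_scale _ _ e _ cB).
have intc : mu.-integrable `[(j i)%:R / (m i)%:R, (j i).+1%:R / (m i)%:R] (EFin \o (fun=> c)).
  by apply: integrable_segment => u; exact: cvg_cst.
rewrite /coord_integral (RintegralD _ intc inteB)// integral_segment_cst//.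
rewrite (RintegralZl _ _ intB)// cellB mulrDr mulrCA divff ?mulr1 ?lt0r_neq0//.
by rewrite mulrCA.
Qed.

(** The hypothesis encloses [G] between [c - B] and [c + B]; means are monotone and preserve such
    affine expressions. *)
Lemma block_mean_dist i G B y c : continuous G -> continuous B ->
  (forall x, `|c - G x| <= B x) -> `|c - bmean i G y| <= bmean i B y.
Proof.
move=> cG cB GB; rewrite ler_distlC.
have cS e : continuous (fun x => c + e * B x).
  by apply: continuous_add; [move=> ?; exact: cst_continuous|exact: continuous_scale].
have := block_mean_affine i y c (- 1) cB; rewrite mulN1r => <-.
have := block_mean_affine i y c 1 cB; rewrite mul1r => <-.
by apply/andP; split; apply: block_mean_le => // x;
  move: (GB x); rewrite ler_distlC ?mulN1r ?mul1r => /andP[].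
Qed.

Lemma block_mean_extremal i Phi y : continuous Phi -> norm_homo Phi ->
  (~~ r i -> half_concave i Phi) ->
  bmean i (fun x => Phi (x0 - x)) y <= extremal_mean i Phi (x0 - y).
Proof.
move=> cP hP kP; have m0 := m_gt0 i; have /andP[jx1 jx2] := jx i.
rewrite /block_mean /extremal_mean; case: ifP kP => [_ _|_ /(_ isT) kP].
  rewrite ler_wpM2l// /coord_integral; under eq_Rintegral do rewrite subr_upd.
  have cf : continuous (fun u => Phi (upd (x0 - y) i u)) by exact: continuous_comp_upd.
  have := integral_segment_fold (jx i) cf; rewrite cellB; apply => u v uv.
  exact: norm_homo_upd.
rewrite /coord_sum big_bool /= !subr_upd addn1 addn0.
set a := (j i)%:R / (m i)%:R; set b := (j i).+1%:R / (m i)%:R; set z := x0 - y.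
set t := hat false (m i) (j i) (x0 ord0 i).
have t0 : 0 <= t by exact: hat_ge0.
have t1 : 0 <= 1 - t by exact: hat_ge0 i true.
have p0 : 0 <= x0 ord0 i - a by rewrite subr_ge0.
have q0 : 0 <= b - x0 ord0 i by rewrite subr_ge0.
have bE : b - a = (m i)%:R^-1 by exact: cellB.
(* Evenness replaces [x0_i - b] by [b - x0_i], so that both arguments are nonnegative and Jensen's
   inequality applies. *)
apply: (@le_trans _ _ (t * Phi (upd z i (x0 ord0 i - a)) +
    (1 - t) * Phi (upd z i (b - x0 ord0 i)))).
  rewrite addrC lerD2l ler_wpM2l//; apply: norm_homo_upd => //.
  by rewrite distrC.
apply: le_trans (kP _ _ _ _ p0 q0 _) _; first by rewrite t0 -subr_ge0.
apply: norm_homo_upd => //.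
(* The mean distance to the two nodes, at most [1 / (2 m_i)] because [4 t (1 - t) <= 1]. *)
have E : t * (x0 ord0 i - a) + (1 - t) * (b - x0 ord0 i) =
    2 * (t * (1 - t)) / (m i)%:R.
  have tE : t / (m i)%:R = b - x0 ord0 i by rewrite /t hat_false mulrC mulKf ?lt0r_neq0.
  have tE' : (1 - t) / (m i)%:R = x0 ord0 i - a.
    by rewrite mulrBl tE mul1r -bE; ring.
  by rewrite -tE -tE'; ring.
rewrite E ger0_norm ?divr_ge0 ?mulr_ge0// ger0_norm ?invr_ge0 ?mulr_ge0// invfM.
rewrite ler_pM2r ?invr_gt0//.
have := sqr_ge0 (2 * t - 1); rewrite expr2 => H.
by lra.
Qed.

(** From the end point [0] the distance to [u] is [u] itself, and the midpoint is at distance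
    [1 / (2 m_i)] from both nodes. *)
Lemma block_mean_extremal_eq i Phi y : norm_homo Phi -> j i = 0%N ->
  x0 ord0 i = (if r i then 0 else (2 * (m i)%:R)^-1) ->
  bmean i (fun x => Phi (x0 - x)) y = extremal_mean i Phi (x0 - y).
Proof.
move=> hP j0 x0i; have m0 := m_gt0 i.
rewrite /block_mean /extremal_mean; case: ifP x0i => _ x0i.
  rewrite j0 mul0r mul1r.
  congr (_ * _); apply: eq_Rintegral => u _; rewrite subr_upd x0i sub0r.
  apply: norm_homo_eq => // k; rewrite !updE; case: eqP => // _; exact: normrN.
have m2 : (m i)%:R^-1 - (2 * (m i)%:R)^-1 = (2 * (m i)%:R)^-1 :> R.
  by field; rewrite lt0r_neq0.
have E (b : bool) : Phi (x0 - upd y i ((j i + b)%:R / (m i)%:R)) =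
    Phi (upd (x0 - y) i (2 * (m i)%:R)^-1).
  rewrite subr_upd x0i j0 add0n; apply: norm_homo_eq => // k; rewrite !updE.
  case: eqP => // _; case: b; last by rewrite /= mulr0n mul0r subr0.
  by rewrite /= mulr1n mul1r distrC m2.
rewrite /coord_sum; under eq_bigr => b _ do rewrite E.
by rewrite -mulr_suml hat_sum mul1r.
Qed.

End Cell.

End Majorant.

(** * Iterating the bound over all directions *)

Section Majorization.
Context {R : realType} {n : nat}.
Local Notation V := 'rV[R]_n.
Implicit Types (x y z : V) (i k : 'I_n) (F G B Phi : V -> R) (s : seq 'I_n).
Variables (r : {ffun 'I_n -> bool}) (m : 'I_n -> nat).

Lemma continuous_rsub x : continuous (fun y : V => x - y).
Proof.
apply: continuous_row => k.
rewrite (_ : (fun _ => _) = (fun y : V => x ord0 k + (-1) * y ord0 k)); last first.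
  by apply/funext => y; rewrite !mxE mulN1r.
apply: continuous_add; first by move=> ?; exact: cst_continuous.
by apply: continuous_scale; exact: continuous_coord.
Qed.

Lemma continuous_comp_rsub x Phi : continuous Phi -> continuous (fun y => Phi (x - y)).
Proof.
move=> cP y; apply: (@cvg_comp _ _ _ (fun y => x - y) Phi); last exact: cP.
exact: continuous_rsub.
Qed.

Section Iterate.
Variables (j : 'I_n -> nat) (x0 : V).
Hypothesis jm : forall i, (j i < m i)%N.
Hypothesis jx : forall i, (j i)%:R / (m i)%:R <= x0 ord0 i <= (j i).+1%:R / (m i)%:R.

Local Notation bmeans s := (fun G => foldr (block_mean m r j x0) G s).
Local Notation emeans s := (fun G => foldr (extremal_mean r m) G s).

Lemma continuous_bmeans s G : continuous G -> continuous (bmeans s G).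
Proof. by move=> cG; elim: s => //= i s; exact: continuous_block_mean. Qed.

Lemma continuous_emeans s G : continuous G -> continuous (emeans s G).
Proof. by move=> cG; elim: s => //= i s; exact: continuous_extremal_mean. Qed.

Lemma norm_homo_emeans s G : continuous G -> norm_homo G -> norm_homo (emeans s G).
Proof.
move=> cG hG; elim: s => //= i s; apply: norm_homo_extremal_mean.
exact: continuous_emeans.
Qed.

Lemma half_concave_emeans k s G : k \notin s -> continuous G ->
  half_concave k G -> half_concave k (emeans s G).
Proof.
move=> + cG kG; elim: s => //= i s IHs; rewrite inE negb_or => /andP[ki ks].
apply: half_concave_extremal_mean; first by rewrite eq_sym.
  exact: continuous_emeans.
exact: IHs.
Qed.

Lemma bmeans_dist s G B y c : continuous G -> continuous B ->
  (forall x, `|c - G x| <= B x) -> `|c - bmeans s G y| <= bmeans s B y.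
Proof.
move=> cG cB GB; elim: s y => [|i s IHs] y /=; first exact: GB.
by apply: block_mean_dist => //; exact: continuous_bmeans.
Qed.

(** The inner means are bounded first. Their bound is again a function of [x0 - x] that is monotone
    in absolute values, and it stays concave in the directions still to come because [s] has no
    repetition. *)
Lemma bmeans_le_emeans s Phi y : uniq s -> continuous Phi -> norm_homo Phi ->
  (forall k, ~~ r k -> half_concave k Phi) ->
  bmeans s (fun x => Phi (x0 - x)) y <= emeans s Phi (x0 - y).
Proof.
move=> + cP hP kP; elim: s y => [|i s IHs] y //= /andP[iNs us].
apply: (@le_trans _ _ (block_mean m r j x0 i (fun x => emeans s Phi (x0 - x)) y)).
  apply: block_mean_le => // [||x]; last exact: IHs.
    by apply: continuous_bmeans; exact: continuous_comp_rsub.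
  by apply: continuous_comp_rsub; exact: continuous_emeans.
apply: block_mean_extremal => //.
- exact: continuous_emeans.
- exact: norm_homo_emeans.
- by move=> ri; apply: half_concave_emeans => //; exact: kP.
Qed.

Lemma bmeans_eq_emeans s Phi y : continuous Phi -> norm_homo Phi ->
  (forall i, j i = 0%N) ->
  (forall i, x0 ord0 i = (if r i then 0 else (2 * (m i)%:R)^-1)) ->
  bmeans s (fun x => Phi (x0 - x)) y = emeans s Phi (x0 - y).
Proof.
move=> cP hP j0 x0E; elim: s y => //= i s IHs y.
rewrite (_ : bmeans s _ = fun x => emeans s Phi (x0 - x)); last exact/funext.
by apply: block_mean_extremal_eq => //; exact: norm_homo_emeans.
Qed.

End Iterate.

Lemma coord_integrals_indep s (a b : 'I_n -> R) G x y :
  (forall k, k \notin s -> x ord0 k = y ord0 k) ->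
  coord_integrals s a b G x = coord_integrals s a b G y.
Proof.
elim: s x y => [|i s IHs] x y xy.
  by congr G; apply/rowP => k; exact: xy.
apply: eq_Rintegral => u _; apply: IHs => k ks; rewrite !updE.
by case: eqP => // /eqP ki; apply: xy; rewrite inE negb_or ki.
Qed.

(** Every coordinate is either integrated or replaced by [1 / (2 m_i)], which is why [z]
    disappears. *)
Lemma foldr_extremal_meanE Phi z : continuous Phi ->
  foldr (extremal_mean r m) Phi ([seq i <- enum 'I_n | ~~ r i] ++ support_seq r) z =
  (\prod_(i < n | r i) (m i)%:R) *
  coord_integrals (support_seq r) (fun=> 0) (fun i => (m i)%:R^-1) Phi
    (\row_i (2 * (m i)%:R)^-1).
Proof.
move=> cP; rewrite foldr_cat.
have {1}-> : foldr (extremal_mean r m) Phi (support_seq r) = fun z =>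
    (\prod_(i <- support_seq r) (m i)%:R) *
    coord_integrals (support_seq r) (fun=> 0) (fun i => (m i)%:R^-1) Phi z.
  have : all r (support_seq r) by exact: filter_all.
  elim: (support_seq r) => [_|i s IHs /= /andP[ri rs]].
    by apply/funext => y; rewrite big_nil mul1r.
  rewrite IHs// /extremal_mean ri; apply/funext => y.
  rewrite big_cons -mulrA; congr (_ * _); rewrite /coord_integral RintegralZl//.
  by apply: integrable_coord; exact: continuous_coord_integrals.
have E s G y : all [pred i | ~~ r i] s ->
    foldr (extremal_mean r m) G s y =
    G (\row_k if k \in s then (2 * (m k)%:R)^-1 else y ord0 k).
  elim: s y => [|i s IHs] y /=; first by move=> _; congr G; apply/rowP => k; rewrite mxE.
  move=> /andP[/negbTE ri rs]; rewrite /extremal_mean ri IHs//; congr G.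
  apply/rowP => k; rewrite !mxE inE.
  by case: ifP => ks; rewrite ?orbT// orbF; case: eqP => [->|].
rewrite E ?filter_all//; congr (_ * _).
  by rewrite big_filter big_enum_cond.
apply: coord_integrals_indep => k; rewrite mem_filter mem_enum andbT => rk.
by rewrite !mxE mem_filter mem_enum /= rk.
Qed.

End Majorization.

(** * Even extension of an MC-type function *)

Section MCType.
Context {R : realType} {n : nat}.
Local Notation V := 'rV[R]_n.
Implicit Types (x y z : V) (i k : 'I_n) (s : seq 'I_n).

(** The hypotheses on [Omega] concern the orthant only; [Omega \o absx] extends it from there to a
    function that is continuous everywhere. *)
Definition absx x : V := \row_k `|x ord0 k|.

Lemma orthant_absx x : orthant (absx x).
Proof. by move=> k; rewrite mxE. Qed.

Lemma absx_id x : orthant x -> absx x = x.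
Proof. by move=> x0; apply/rowP => k; rewrite mxE ger0_norm. Qed.

Lemma continuous_absx : continuous absx.
Proof.
apply: continuous_row => k.
rewrite (_ : (fun _ => _) = Num.norm \o (fun x => x ord0 k)); last first.
  by apply/funext => x; rewrite mxE.
move=> x; apply: cvg_comp; first exact: continuous_coord.
exact: norm_continuous.
Qed.

Variable Omega : V -> R.
Hypothesis Omega_mc : mc_type Omega.

Lemma continuous_mc_absx : continuous (Omega \o absx).
Proof.
apply: (continuous_comp_within (mc_type_continuous Omega_mc) continuous_absx).
exact: orthant_absx.
Qed.

Lemma norm_homo_mc_absx : norm_homo (Omega \o absx).
Proof.
move=> x y xy; apply: (mc_type_homo Omega_mc); try exact: orthant_absx.
by move=> k; rewrite !mxE.
Qed.

(** Apply monotonicity and subadditivity to [|u| <= |u - v| + |v|], taken coordinatewise. This is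
    the modulus condition for the extremal function. *)
Lemma mc_absx_dist x y : `|Omega (absx x) - Omega (absx y)| <= Omega (absx (x - y)).
Proof.
have H u v : Omega (absx u) - Omega (absx v) <= Omega (absx (u - v)).
  rewrite lerBlDl.
  apply: le_trans (mc_type_subadd Omega_mc (orthant_absx _) (orthant_absx _)).
  apply: (mc_type_homo Omega_mc); first exact: orthant_absx.
    by move=> k; rewrite !mxE addr_ge0.
  by move=> k; rewrite !mxE -{1}(subrK (v ord0 k) (u ord0 k)) addrC ler_normD.
rewrite ler_norml H lerNl opprB (le_trans (H _ _))//.
by apply: norm_homo_mc_absx => k; rewrite !mxE distrC.
Qed.

Lemma half_concave_mc_absx k : concave_coord Omega k -> half_concave k (Omega \o absx).
Proof.
move=> cO x p q t p0 q0 /andP[t0 t1].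
have E u : 0 <= u -> (Omega \o absx) (upd x k u) = Omega (upd (absx x) k u).
  move=> u0; rewrite /=; congr Omega; apply/rowP => l; rewrite !mxE.
  by case: eqP => // _; rewrite ger0_norm.
have u0 : 0 <= 1 - t by rewrite subr_ge0.
rewrite !E ?addr_ge0 ?mulr_ge0//.
have pI : p \in (`[0, +oo[%classic : set R^o) by rewrite inE/= in_itv/= p0.
have qI : q \in (`[0, +oo[%classic : set R^o) by rewrite inE/= in_itv/= q0.
have H : - Omega (upd (absx x) k (t * p + (1 - t) * q)) <=
    t * - Omega (upd (absx x) k p) + (1 - t) * - Omega (upd (absx x) k q).
  exact: (cO _ (orthant_absx x) (Itv01 t0 t1) _ _ pI qI).
by rewrite -lerN2; apply: le_trans H _; rewrite opprD !mulrN.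
Qed.

Lemma box_integral_mc s (b : 'I_n -> R) h : orthant h ->
  box_integral s b Omega h = coord_integrals s (fun=> 0) b (Omega \o absx) h.
Proof.
elim: s h => [|i s IHs] h h0 /=; first by rewrite absx_id.
apply: eq_Rintegral => u; rewrite inE/= in_itv/= => /andP[u0 _]; apply: IHs => k.
by rewrite updE; case: eqP.
Qed.

End MCType.

(** * Upper and lower bounds for the error on the class *)

Section ApproximationError.
Context {R : realType} {n : nat}.
Local Notation V := 'rV[R]_n.
Variables (r : {ffun 'I_n -> bool}) (Omega : V -> R) (m : 'I_n -> nat).
Hypothesis Omega_mc : mc_type Omega.
Hypothesis m_gt0 : forall i, (0 < m i)%N.

Let sq := [seq i <- enum 'I_n | ~~ r i] ++ support_seq r.

Let bound : R := (\prod_(i < n | r i) (m i)%:R) *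
  box_integral (support_seq r) (fun i => (m i)%:R^-1) Omega (\row_i (2 * (m i)%:R)^-1).

Let bound_emeans z : foldr (extremal_mean r m) (Omega \o absx) sq z = bound.
Proof.
rewrite foldr_extremal_meanE; last exact: continuous_mc_absx.
by rewrite /bound box_integral_mc// => k; rewrite mxE invr_ge0 mulr_ge0.
Qed.

Let sq_uniq : uniq sq.
Proof.
rewrite cat_uniq support_seq_uniq filter_uniq ?enum_uniq// andbT; apply/hasPn => i.
by rewrite /= !mem_filter => /andP[->].
Qed.

Let cell_lt (x : V) i : (cell_index m x i < m i)%N.
Proof. by rewrite /cell_index -[X in (_ < X)%N](prednK (m_gt0 i)) ltnS geq_minr. Qed.

Let cell_mem (x : V) : cube x -> forall i,
  (cell_index m x i)%:R / (m i)%:R <= x ord0 i <= (cell_index m x i).+1%:R / (m i)%:R.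
Proof.
move=> Dx i; have /(_ i)[-> /=] := (cell_indexP m_gt0 Dx (cell_lt x)).2 erefl.
by case: ifP => // _ /ltW.
Qed.

Let approxE (f : V -> R) x : smooth r f -> cube x -> spline_deriv m r f x =
  foldr (block_mean m r (cell_index m x) x) (mixed_deriv cube r f \o clamp) sq x.
Proof. by move=> sf Dx; rewrite /spline_deriv (mixed_deriv_block_poly (cell_lt x)). Qed.

Lemma approx_error_le : (forall i, r i = false -> concave_coord Omega i) ->
  (approx_error m r (smooth_class r Omega) <= bound%:E)%E.
Proof.
move=> kO; apply: ge_ereal_sup => _ [f [sf fO] <-].
apply: ge_ereal_sup => _ [x Dx <-]; rewrite lee_fin approxE//.
have cf : continuous (mixed_deriv cube r f \o clamp).
  by apply: continuous_comp_clamp; have [] := sf r (fun i => leqnn _).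
(* The class condition is used with [tau = |x - clamp y|]. It extends to every [y], since clamping
   brings [y] no farther from [x] in any coordinate. *)
have fD y : `|mixed_deriv cube r f x - (mixed_deriv cube r f \o clamp) y| <=
    (Omega \o absx) (x - y).
  apply: (@le_trans _ _ ((Omega \o absx) (x - clamp y))).
    have Dxy : cube (absx (x - clamp y)).
      move=> k; rewrite !mxE normr_ge0/= ler_norml.
      have /andP[? ?] := Dx k; have := cube_clamp y k; rewrite mxE => /andP[? ?].
      by apply/andP; split; lra.
    rewrite -lee_fin; apply: le_trans (fO _ Dxy); apply: ereal_sup_ubound.
    exists x, (clamp y); split => //; first exact: cube_clamp.
    by move=> k; rewrite !mxE.
  apply: norm_homo_mc_absx => // k; rewrite !mxE.
  have /andP[xk0 xk1] := Dx k.
  have [y0|y0] := leP 0 (y ord0 k); last first.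
    by rewrite min_r// subr0 !ger0_norm; lra.
  have [y1|y1] := leP (y ord0 k) 1; first by [].
  by rewrite !ler0_norm; lra.
apply: (@le_trans _ _ (foldr (block_mean m r (cell_index m x) x)
    (fun y => (Omega \o absx) (x - y)) sq x)).
  apply: bmeans_dist fD => //; first exact: cell_mem.
  by apply: continuous_comp_rsub; exact: continuous_mc_absx.
(* The iterated extremal mean has the same value everywhere; [x - x] is the point where the
   comparison of means yields it. *)
rewrite -(bound_emeans (x - x)).
apply: bmeans_le_emeans => //.
- exact: cell_mem.
- exact: continuous_mc_absx.
- exact: norm_homo_mc_absx.
- by move=> k /negbTE rk; apply: half_concave_mc_absx; exact: kO.
Qed.

Let x0 : V := \row_i (if r i then 0 else (2 * (m i)%:R)^-1).

Let x0E i : x0 ord0 i = (if r i then 0 else (2 * (m i)%:R)^-1).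
Proof. by rewrite mxE. Qed.

Let cube_x0 : cube x0.
Proof.
move=> i; rewrite x0E; case: (r i); first by rewrite lexx ler01.
have m1 : 1 <= (m i)%:R :> R by rewrite ler1n.
by rewrite invr_ge0 mulr_ge0//= invf_le1; lra.
Qed.

Let cell_x0 i : cell_index m x0 i = 0%N.
Proof.
have mR : 0 < (m i)%:R :> R by rewrite ltr0n.
have /andP[x00 _] := cube_x0 i.
apply/eqP; rewrite -leqn0 /cell_index geq_min; apply/orP; left.
rewrite -ltnS Num.Theory.truncn_lt_nat ?mulr_ge0// x0E.
case: (r i); first by rewrite mul0r.
(* Here [x0_i m_i = 1 / 2], whose integer part is [0]. *)
by rewrite invfM -mulrA mulVf ?lt0r_neq0//; lra.
Qed.

Lemma approx_error_ge : (bound%:E <= approx_error m r (smooth_class r Omega))%E.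
Proof.
(* The prescribed mixed derivative; [f] is an iterated primitive of it. *)
pose g x := (Omega \o absx) (x0 - x).
have cg : continuous g by apply: continuous_comp_rsub; exact: continuous_mc_absx.
pose f := coord_primitives (support_seq r) g.
have [sf fg] : smooth r f /\ forall x, cube x -> mixed_deriv cube r f x = g x.
  exact: smooth_coord_primitives.
have fO : smooth_class r Omega f.
  split=> // tau Dtau; apply: ge_ereal_sup => _ [x [y [Dx Dy xy ->]]].
  rewrite lee_fin !fg//; apply: le_trans (mc_absx_dist Omega_mc _ _) _.
  apply: (mc_type_homo Omega_mc); first exact: orthant_absx.
    by move=> k; case/andP: (Dtau k).
  move=> k; apply: le_trans (xy k); rewrite !mxE.
  by rewrite opprB addrC addrA subrK distrC.
apply: (le_ereal_sup_tmp (ex_intro2 _ _ _ _ _)); first by exists f.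
apply: (le_ereal_sup_tmp (ex_intro2 _ _ _ _ _)); first by exists x0.
rewrite lee_fin approxE//.
rewrite (@foldr_block_mean_congr _ _ _ _ (cell_lt x0) _ _ _ _ g)//; last first.
  by move=> y Dy; rewrite /= clamp_id// fg.
rewrite bmeans_eq_emeans//.
(* Since [g] vanishes at [x0], the error there is the absolute value of the mean alone. *)
- rewrite bound_emeans fg// /g subrr /= (_ : absx 0 = 0); last first.
    by apply/rowP => k; rewrite !mxE normr0.
  by rewrite mc_type0// sub0r normrN ler_norm.
- exact: continuous_mc_absx.
- exact: norm_homo_mc_absx.
Qed.

End ApproximationError.

Theorem theorem3 (R : realType) (n : nat) (r : {ffun 'I_n -> bool})
    (Omega : 'rV[R]_n -> R) (m : 'I_n -> nat)
    (n_ge1 : (1 <= n)%N)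
    (Omega_mc : mc_type Omega)
    (Omega_concave : forall i, r i = false -> concave_coord Omega i)
    (m_ge2 : forall i, (2 <= m i)%N) :
  approx_error m r (smooth_class r Omega) =
  ((\prod_(i < n | r i) (m i)%:R) *
   box_integral (support_seq r) (fun i => (m i)%:R^-1) Omega
     (\row_i (2 * (m i)%:R)^-1))%:E.
Proof.
have m_gt0 i : (0 < m i)%N by exact: leq_trans (m_ge2 i).
by apply: le_anti; rewrite approx_error_le// approx_error_ge.
Qed.
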